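(* For any integer $n_0$ there exist an integer $n\ge n_0$ and a block design $(S;A_1,\dots,A_m)$ such that $|S|=n$, $|A_i|>0.6\sqrt{n}$ for every $i\in\{1,\dots,m\}$, and for every transversal $Q$ of $(S;A_1,\dots,A_m)$ there exists an $i\in\{1,\dots,m\}$ such that $$|Q\cap A_i|\ge \frac{\log n}{100\log\log n}.$$
   Context: Let $S$ be a finite set and $A_1,\dots,A_m$ subsets of $S$, called blocks. $(S;A_1,\dots,A_m)$ is a (pairwise balanced) block design if every pair of distinct elements of $S$ is contained in exactly one block. A transversal of the block design is a subset $Q\subseteq S$ having non-empty intersection with every block $A_i$. Here $\log$ denotes the natural logarithm. *)

(* Defs.v *)
From mathcomp Require Import all_boot.

Set Implicit Arguments.
Unset Strict Implicit.
Unset Printing Implicit Defensive.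

(* The blocks form an indexed family, and "exactly one block" means exactly   *)
(* one index.                                                                 *)
Definition block_design (S : finType) (m : nat) (A : 'I_m -> {set S}) : Prop :=
  forall x y : S, x != y -> exists! i : 'I_m, x \in A i /\ y \in A i.

Definition block_transversal (S : finType) (m : nat) (A : 'I_m -> {set S})
    (Q : {set S}) : Prop :=
  forall i : 'I_m, Q :&: A i != set0.

(* Main.v *)
(**
Take an affine plane of large prime order q, and let S be a random half of its
points; the blocks are the traces on S of the lines.  With high probability all
blocks have about q/2 points while |S| is about q^2/2.  Let Q be a subset of S
meeting every line in at most t points, t of order log q / log log q.

Containers.  Weight the sets A contained in a point set C, for which A u F has
all loads at most t, by lam^|A| (hard-core model).  If |C| is much larger than
t q, some point v of C is blocked with probability at least 1/(8t): otherwise a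
t-subset T of a line l through v can be added to almost every A missing l, which
gives a lower bound for the probability that A meets l exactly in T, and then the
second moment method over the q/2 suitable lines through v shows that v is often
on a line of load t.  Asking whether v is in Q either removes v from C or
puts v in the fingerprint F and shrinks the partition function by 1 - 1/(8t).
Hence Q lies in F u Z for one of at most exp(q / polylog q) pairs (F, Z) with
|F| <= q/8 and |Z| of order t q.

A fixed pair fails.  A typical line missing F has O(t) points in Z, and S misses
all of them with probability at least 1/q, so the complement of S should
contain the trace on Z of some line missing F.  The sets D containing no such
trace form a down-set, and the same second moment argument shows that many
points of Z are blocked for a random D in it, so that D is noticeably smaller
than half of Z on average; by Chernoff's bound such sets D are exponentially rare,
rarer than the number of pairs (F, Z).  Therefore some S has no transversal with
all loads at most t.
*)
Require Import Defs.
From mathcomp Require Import all_boot all_order all_algebra.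
From mathcomp Require Import reals exp.
From mathcomp Require Import sequences ring lra zify.

Set Implicit Arguments.
Unset Strict Implicit.
Unset Printing Implicit Defensive.

Import Order.TTheory GRing.Theory Num.Theory.

Local Open Scope ring_scope.

(** * Lines and second moments *)

(** Families of sets are compared below mostly through injections that add, remove or exchange a
    fixed set of points. *)
Lemma ler_sum_inj (R : realFieldType) (T T' : finType) (D : {pred T})
    (E : {pred T'}) (h : T -> T') (f : T -> R) (g : T' -> R) :
  {in D &, injective h} -> {in D, forall x, h x \in E} ->
  {in D, forall x, f x <= g (h x)} -> (forall y, 0 <= g y) ->
  \sum_(x in D) f x <= \sum_(y in E) g y.
Proof.
move=> h_inj hE fg g0.
apply: (le_trans (ler_sum _ fg)).
pose A := [set x in D].
have -> : \sum_(x in D) g (h x) = \sum_(x in A) g (h x).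
  by apply: eq_bigl => x; rewrite inE.
rewrite -(big_imset g); last by move=> x y; rewrite !inE => xD yD; exact: h_inj.
rewrite [leRHS](bigID [in h @: A]) /= -[leLHS]addr0 lerD //; last exact: sumr_ge0.
rewrite le_eqVlt; apply/orP; left; apply/eqP; apply: eq_bigl => y.
apply/idP/idP => [yA|/andP[]//]; rewrite yA andbT.
by case/imsetP: yA => x; rewrite inE => xD ->; exact: hE.
Qed.

(* If [X] counts the events that occur, then [2 w X - (w X) ^ 2] is at most 1
   and vanishes at [X = 0]; the scale [w = 1 / (4 Y)] is chosen below. *)
Lemma second_moment_bound (R : realFieldType) (T I : finType) (w : T -> R)
    (U : pred T) (G : {set I}) (B : I -> pred T) (y : I -> R) (c rho : R) :
  (forall A, 0 <= w A) -> 0 <= rho -> 0 <= c ->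
  (forall i, 0 <= y i) -> 1 / 4 <= \sum_(i in G) y i ->
  (forall i A, i \in G -> B i A -> U A) ->
  {in G, forall i, c * y i * rho <= \sum_(A | B i A) w A} ->
  {in G &, forall i j, i != j ->
    \sum_(A | B i A && B j A) w A <= y i * y j * rho} ->
  (c / 4 - 1 / 16) * rho <= \sum_(A | U A) w A.
Proof.
move=> w0 rho0 c0 y0 Y14 BU B1 B2.
set Y := \sum_(i in G) y i in Y14.
have Y0 : 0 < Y by lra.
pose s := 1 / (4 * Y).
have sY : s * Y = 1 / 4 by rewrite /s; field; lra.
have s0 : 0 < s by apply: divr_gt0; lra.
have s1 : s <= 1 by rewrite /s ler_pdivrMr; lra.
pose X A : R := \sum_(i in G) (B i A)%:R.
have XU A : (2 * s * X A - (s * X A) ^+ 2) * w A <= (U A)%:R * w A.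
  apply: ler_wpM2r => //.
  have [UA|nUA] := boolP (U A); first by have := sqr_ge0 (s * X A - 1); rewrite mulr1n; lra.
  suff -> : X A = 0 by rewrite !mulr0 expr0n subrr.
  by rewrite /X big1 // => i iG; case: (boolP (B i A)) => // /BU -/(_ iG); rewrite (negPf nUA).
have -> : \sum_(A | U A) w A = \sum_A (U A)%:R * w A.
  by rewrite big_mkcond; apply: eq_bigr => A _; case: (U A); rewrite ?mul1r ?mul0r.
apply: (le_trans _ (ler_sum _ (fun A _ => XU A))).
have EX : \sum_A X A * w A = \sum_(i in G) \sum_(A | B i A) w A.
  under eq_bigr => A _ do rewrite /X mulr_suml.
  rewrite exchange_big /=; apply: eq_bigr => i _.
  by rewrite [RHS]big_mkcond; apply: eq_bigr => A _; case: (B i A); rewrite ?mul1r ?mul0r.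
have EXX : \sum_A X A ^+ 2 * w A =
    \sum_(i in G) \sum_(j in G) \sum_(A | B i A && B j A) w A.
  under eq_bigr => A _ do rewrite expr2 /X mulr_suml mulr_suml.
  rewrite exchange_big /=; apply: eq_bigr => i _.
  under eq_bigr => A _ do rewrite mulr_sumr mulr_suml.
  rewrite exchange_big /=; apply: eq_bigr => j _.
  rewrite [RHS]big_mkcond; apply: eq_bigr => A _.
  by case: (B i A); case: (B j A); rewrite ?mul1r ?mul0r ?mulr0 ?mul0r.
(* The diagonal of the double sum is the first moment, and the off-diagonal terms sum to at most
   [Y ^+ 2 * rho]. *)
have EXX_le : \sum_A X A ^+ 2 * w A <= \sum_A X A * w A + Y ^+ 2 * rho.
  rewrite EXX EX expr2 {1}/Y !mulr_suml -big_split /=; apply: ler_sum => i iG.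
  rewrite (bigD1 i) //=; apply: lerD.
    by rewrite le_eqVlt; apply/orP; left; apply/eqP; apply: eq_bigl => A; rewrite andbb.
  apply: (@le_trans _ _ (\sum_(j in G | j != i) y i * y j * rho)).
    by apply: ler_sum => j /andP[jG ji]; apply: B2; rewrite // eq_sym.
  rewrite /Y [in leRHS](bigD1 i) //= mulrDr mulrDl mulr_sumr mulr_suml.
  by rewrite lerDr; have := y0 i; nra.
have EX_ge : c * Y * rho <= \sum_A X A * w A.
  rewrite EX /Y mulr_sumr mulr_suml; exact: ler_sum.
have -> : \sum_A (2 * s * X A - (s * X A) ^+ 2) * w A =
    2 * s * (\sum_A X A * w A) - s ^+ 2 * (\sum_A X A ^+ 2 * w A).
  rewrite !mulr_sumr -sumrB; apply: eq_bigr => A _; ring.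
set E1 := \sum_A X A * w A in EX_ge EXX_le *.
set E2 := \sum_A X A ^+ 2 * w A in EXX_le *.
have cY : 0 <= c * Y * rho by rewrite !mulr_ge0 // ltW.
(* As [s <= 1], the diagonal costs at most one of the two copies of [s * E1]; the other one supplies
   [c / 4 * rho]. *)
have h1 : s ^+ 2 * E2 <= s * E1 + 1 / 16 * rho.
  have -> : 1 / 16 * rho = s ^+ 2 * (Y ^+ 2 * rho).
    by rewrite mulrA -exprMn sY; lra.
  apply: (@le_trans _ _ (s ^+ 2 * (E1 + Y ^+ 2 * rho))).
    by rewrite ler_wpM2l // sqr_ge0.
  rewrite mulrDr lerD2r expr2 -mulrA ler_pM2l //.
  by rewrite ler_piMl //; lra.
have h2 : c / 4 * rho <= s * E1.
  have -> : c / 4 * rho = s * (c * Y * rho).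
    have -> : s * (c * Y * rho) = c * (s * Y) * rho by ring.
    by rewrite sY; lra.
  by rewrite ler_pM2l.
lra.
Qed.

(** * Incidence counts in an affine plane *)

Section Plane.
Variables (P L : finType) (pts : L -> {set P}) (q : nat).

Definition affine_plane : Prop :=
  [/\ #|P| = (q * q)%N, forall l, #|pts l| = q,
      forall x, #|[set l | x \in pts l]| = q.+1
    & forall x y, x != y -> #|[set l | (x \in pts l) && (y \in pts l)]| = 1%N].

Definition load_le (t : nat) (X : {set P}) : bool :=
  [forall l, #|X :&: pts l| <= t]%N.

Hypothesis plane : affine_plane.
Hypothesis q_gt0 : (0 < q)%N.

Lemma line_inj x y l l' :
  x \in pts l -> x \in pts l' -> y \in pts l -> y \in pts l' -> x != y ->
  l = l'.
Proof.
case: plane => _ _ _ two xl xl' yl yl' xy.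
have /eqP/cards1P[k kE] := two _ _ xy.
have : l \in [set k] by rewrite -kE inE xl.
have : l' \in [set k] by rewrite -kE inE xl'.
by rewrite !inE => /eqP-> /eqP->.
Qed.

Lemma card_lines : #|L| = (q * q.+1)%N.
Proof.
case: plane => cP cl deg _.
have : (\sum_(l : L) #|pts l| = \sum_(x : P) #|[set l | x \in pts l]|)%N.
  under eq_bigr => l _ do rewrite -sum1_card big_mkcond.
  under [RHS]eq_bigr => x _ do rewrite -sum1_card big_mkcond.
  rewrite exchange_big; apply: eq_bigr => x _; apply: eq_bigr => l _.
  by rewrite inE.
under eq_bigr => l _ do rewrite cl.
under [RHS]eq_bigr => x _ do rewrite deg.
rewrite !sum_nat_const cP => /eqP.
by rewrite [(_ * q)%N]mulnC -mulnA eqn_pmul2l // => /eqP.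
Qed.

(** The lines through [v] partition the points other than [v]. *)
Lemma sum_pencil (R : realFieldType) (v : P) (C : {set P}) (f : P -> R) :
  \sum_(l | v \in pts l) \sum_(x in C :&: pts l :\ v) f x =
  \sum_(x in C :\ v) f x.
Proof.
case: plane => _ _ _ two.
rewrite (exchange_big_dep [in C :\ v]) /=; last first.
  by move=> l x _; rewrite !inE => /and3P[-> ->].
apply: eq_bigr => x; rewrite !inE => /andP[xv xC].
rewrite (eq_bigl [in [set l | (v \in pts l) && (x \in pts l)]]); last first.
  by move=> l; rewrite !inE xv xC.
by rewrite sumr_const two ?mulr1n // eq_sym.
Qed.

(** Two lines through [v] share no point of [F], so choosing a point of [F] on each line is
    injective. *)
Lemma card_pencil_hit v (F : {set P}) : v \notin F ->
  (#|[set l | (v \in pts l) && (F :&: pts l != set0)]| <= #|F|)%N.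
Proof.
move=> vF; set A := [set l | _].
(* The default [v] is never taken on [A], whose lines meet [F]. *)
pose h l := odflt v [pick x in F :&: pts l].
have hP l : l \in A -> h l \in F :&: pts l.
  by rewrite inE /h => /andP[_ /set0Pn[x xl]]; case: pickP => // /(_ x); rewrite xl.
rewrite -(@card_in_imset _ _ h) => [|l l' lA l'A hE].
  by apply/subset_leq_card/subsetP => _ /imsetP[l /hP + ->]; rewrite inE => /andP[].
have /setIP[hF hl] := hP _ lA; have /setIP[_] := hP _ l'A; rewrite -hE => hl'.
move: lA l'A; rewrite !inE => /andP[vl _] /andP[vl' _].
by apply: (line_inj vl vl' hl hl'); apply: contraNneq vF => ->.
Qed.

(** Markov's inequality for the lines through [v]. *)
Lemma card_pencil_markov (R : realFieldType) v (C : {set P}) (f : P -> R) (a : R) :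
  0 < a -> (forall x, 0 <= f x) ->
  a * #|[set l | (v \in pts l) && (a < \sum_(x in C :&: pts l :\ v) f x)]|%:R
    <= \sum_(x in C) f x.
Proof.
move=> a0 f0.
apply: (@le_trans _ _ (\sum_(x in C :\ v) f x)); last first.
  rewrite [leRHS](bigID (pred1 v)) /= [X in _ <= _ + X](eq_bigl [in C :\ v]).
    by rewrite lerDr sumr_ge0.
  by move=> x; rewrite !inE andbC.
rewrite -(sum_pencil v) [leRHS](bigID (fun l => a < \sum_(x in C :&: pts l :\ v) f x)) /=.
rewrite -[leLHS]addr0 lerD //; last by apply: sumr_ge0 => l _; apply: sumr_ge0.
rewrite -sumr_const mulr_sumr.
under [leLHS]eq_bigl => l do rewrite inE.
by apply: ler_sum => l /andP[_ /ltW]; rewrite mulr1.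
Qed.

End Plane.

(** * A vertex that is often blocked *)

(** A weighted union bound: every failure of [p] is charged to an event indexed by [X]. *)
Lemma sum_set_cover (R : realFieldType) (T I : finType) (w : T -> R)
    (D : {pred T}) (p : pred T) (X : {pred I}) (e : I -> pred T) :
  (forall A, 0 <= w A) ->
  (forall A, A \in D -> ~~ p A -> exists2 x, x \in X & e x A) ->
  \sum_(A in D) w A <=
    \sum_(A in D | p A) w A + \sum_(x in X) \sum_(A in D | e x A) w A.
Proof.
move=> w0 cov; rewrite (bigID p) /= lerD2l.
under [leRHS]eq_bigr => x _ do rewrite big_mkcondr.
rewrite exchange_big big_mkcondr /=; apply: ler_sum => A AD.
have [/=|pA] := boolP (p A); first by move=> _; apply: sumr_ge0 => x _; case: ifP.
have [x xX exA] := cov A AD pA.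
by rewrite (bigD1 x) //= exA lerDl sumr_ge0 // => y _; case: ifP.
Qed.

(** Truncating to exactly [m] points gives every good line the same number of candidate traces. *)
Definition initial_subset (T : finType) (m : nat) (A : {set T}) : {set T} :=
  [set x in take m (enum A)].

Lemma initial_subset_sub (T : finType) m (A : {set T}) :
  initial_subset m A \subset A.
Proof. by apply/subsetP => x; rewrite inE => /mem_take; rewrite mem_enum. Qed.

Lemma card_initial_subset (T : finType) m (A : {set T}) :
  (m <= #|A|)%N -> #|initial_subset m A| = m.
Proof.
move=> mA; rewrite cardsE (card_uniqP (take_uniq _ (enum_uniq _))).
by rewrite size_take -cardE; case: ltngtP mA.
Qed.

Section Weights.
Variables (R : realFieldType) (P : finType) (lam : R).
Hypothesis lam0 : 0 < lam.

Definition down_closed (I : {set {set P}}) :=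
  forall A B : {set P}, A \in I -> B \subset A -> B \in I.

(** Removing [T] is injective on the sets containing it, stays in the family and divides the weight
    by [lam ^+ #|T|]. *)
Lemma weight_superset (I : {set {set P}}) (T : {set P}) : down_closed I ->
  \sum_(A in I | T \subset A) lam ^+ #|A| <=
    lam ^+ #|T| * \sum_(A in I) lam ^+ #|A|.
Proof.
move=> dI; rewrite mulr_sumr.
apply: (@ler_sum_inj R _ _ [pred A | (A \in I) && (T \subset A)] (mem I)
   (fun A => A :\: T)).
- move=> A B; rewrite !inE => /andP[_ TA] /andP[_ TB] AB.
  by rewrite -(setID A T) -(setID B T) AB (setIidPr TA) (setIidPr TB).
- by move=> A; rewrite inE => /andP[AI _]; apply: (dI _ _ AI); exact: subsetDl.
- move=> A; rewrite inE => /andP[_ TA].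
  by rewrite -exprD cardsD (setIidPr TA) subnKC // subset_leq_card.
- by move=> A; rewrite mulr_ge0 // exprn_ge0 // ltW.
Qed.

End Weights.

Section Container.
Variables (R : realFieldType) (P L : finType) (pts : L -> {set P}) (q : nat).
Hypothesis plane : affine_plane pts q.
Hypothesis q_gt0 : (0 < q)%N.
Variable t : nat.

Definition admissible (C F : {set P}) : {set {set P}} :=
  [set A : {set P} | (A \subset C) && load_le pts t (A :|: F)].

Lemma load_le_sub (A B : {set P}) :
  A \subset B -> load_le pts t B -> load_le pts t A.
Proof.
move=> AB /forallP lB; apply/forallP => l.
by apply: leq_trans (lB l); rewrite subset_leq_card // setSI.
Qed.

Lemma admissible_down C F : down_closed (admissible C F).
Proof.
move=> A B; rewrite !inE => /andP[AC lA] BA.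
rewrite (subset_trans BA AC) /=; apply: load_le_sub lA; exact: setSU.
Qed.

Variables C F : {set P}.
Hypothesis CF : [disjoint C & F].
Hypothesis F_small : (8 * #|F| <= q)%N.
Variable m : nat.
Hypothesis m_gt0 : (0 < m)%N.
Hypothesis m_small : (8 * (m * q.+1) <= #|C|)%N.

Let good v := [set l | [&& v \in pts l, F :&: pts l == set0, (m < #|C :&: pts l|)%N
   & \sum_(x in C :&: pts l :\ v) (1 : R) <= 8 * #|C|%:R / q%:R]].

(** Of the [q + 1] lines through [v], at most [q / 8] meet [F], at most [q / 8] are overfull by
    Markov, and at most [q / 8] are poor in points of [C] for a suitable [v]. *)
Lemma exists_rich_vertex : exists2 v, v \in C & (q <= 2 * #|good v|)%N.
Proof.
have [cP cl deg _] := plane.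
pose poor v := [set l | (v \in pts l) && (#|C :&: pts l| <= m)%N].
(* Averaging over [C]: each line is poor for at most [m] points, so there are at most
   [m * q * (q + 1)] incidences of points of [C] with poor lines. *)
have [v vC poor_v] : exists2 v, v \in C & (8 * #|poor v| <= q)%N.
  apply/exists_inP/contraT; rewrite negb_exists_in => /forall_inP poorC.
  have h1 : (\sum_(v in C) #|poor v| <= m * #|L|)%N.
    under eq_bigr => v _ do rewrite -sum1_card.
    rewrite (exchange_big_dep xpredT) //= mulnC -sum_nat_const.
    apply: leq_sum => l _; rewrite sum1_card.
    have [/= lm|lm] := leqP #|C :&: pts l| m.
      apply: leq_trans lm; apply: subset_leq_card; apply/subsetP => x.
      by rewrite !inE /=; case/andP=> ->; rewrite inE => /andP[].
    rewrite eq_card0 // => x; apply/negP => /=.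
    by case/andP=> _; rewrite inE leqNgt lm andbF.
  have h2 : (#|C| * q.+1 <= 8 * \sum_(v in C) #|poor v|)%N.
    rewrite -sum_nat_const big_distrr /=; apply: leq_sum => v /poorC.
    by rewrite -ltnNge.
  move: h1 h2 m_small m_gt0; rewrite (card_lines plane q_gt0).
  move: (\sum_(v in C) _)%N => s; nia.
exists v => //.
have vF : v \notin F by have := disjointFr CF vC => ->.
have C0 : (0 < #|C|)%N by apply/card_gt0P; exists v.
pose hit := [set l | (v \in pts l) && (F :&: pts l != set0)].
pose big := [set l | (v \in pts l) &&
   (8 * #|C|%:R / q%:R < \sum_(x in C :&: pts l :\ v) (1 : R))].
have hitF : (8 * #|hit| <= q)%N.
  by apply: leq_trans F_small; rewrite leq_mul2l /=; exact: (card_pencil_hit plane vF).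
have bigC : (8 * #|big| <= q)%N.
  have q0 : 0 < q%:R :> R by rewrite ltr0n.
  have c0 : 0 < #|C|%:R :> R by rewrite ltr0n.
  have a0 : 0 < 8 * #|C|%:R / q%:R :> R by rewrite divr_gt0 // mulr_gt0.
  have := card_pencil_markov plane v C a0 (fun=> ler01).
  rewrite sumr_const -/big mulrAC ler_pdivrMr // -(ler_nat R) natrM.
  set b := #|big|%:R; set c := #|C|%:R in c0 *; nra.
have cover : [set l | v \in pts l] \subset good v :|: hit :|: poor v :|: big.
  apply/subsetP => l; rewrite !inE => vl; rewrite vl /= ltNge [(_ <= m)%N]leqNgt.
  by case: (F :&: pts l == set0); case: (m < _)%N;
    case: (\sum_(x in C :&: pts l :\ v) (1 : R) <= _).
have := subset_leq_card cover; rewrite deg.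
have := (leq_card_setU (good v :|: hit :|: poor v) big).1.
have := (leq_card_setU (good v :|: hit) (poor v)).1.
have := (leq_card_setU (good v) hit).1.
lia.
Qed.

Variable lam : R.
Hypothesis lam0 : 0 < lam.
Let w (A : {set P}) : R := lam ^+ #|A|.
Let w0 A : 0 <= w A. Proof. by rewrite exprn_ge0 // ltW. Qed.

Let I := admissible C F.
Let rho := \sum_(A in I) w A.

Variable dlt : R.
Hypothesis lam_small : (8 * #|C|%:R / q%:R + 1) * lam <= 1 / 4.
Hypothesis m_large : 1 / 2 <= q%:R * ('C(m, t)%:R * lam ^+ t).
Hypothesis free : {in C, forall x, \sum_(A in I | x |: A \notin I) w A <= dlt * rho}.
Hypothesis dlt_small : t%:R * dlt <= 1 / 4.

Let rho0 : 0 <= rho. Proof. by apply: sumr_ge0. Qed.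

(* Adding [T] to a set [A] that misses [l] is an injective operation of weight
   [lam ^+ t]; every other line meets [T] in at most one point, so the result is
   admissible as soon as each point of [T] is individually free for [A]. *)
Lemma good_load_ge v l (T : {set P}) : l \in good v -> T \subset C :&: pts l :\ v -> #|T| = t ->
  1 / 2 * rho * lam ^+ t <= \sum_(A in I | A :&: pts l == T) w A.
Proof.
rewrite inE => /and4P[vl Fl _ big] TC cT.
have TCl : T \subset C :&: pts l by apply: subset_trans TC _; exact: subD1set.
pose p A := (A :&: pts l == set0) && [forall x in T, x |: A \in I].
have step1 : \sum_(A in I | p A) w A * lam ^+ t
    <= \sum_(A in I | A :&: pts l == T) w A.
  apply: (@ler_sum_inj R _ _ [pred A | (A \in I) && p A]
    [pred A | (A \in I) && (A :&: pts l == T)] (fun A => A :|: T)) => //.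
  - move=> A B; rewrite !inE => /andP[_ /andP[/eqP Al _]] /andP[_ /andP[/eqP Bl _]].
    have cut D : D :&: pts l = set0 -> (D :|: T) :\: T = D.
      move=> Dl; rewrite setDUl setDv setU0; apply/setDidPl.
      rewrite -setI_eq0 -subset0 -Dl; apply: setIS.
      by apply: subset_trans TCl _; exact: subsetIr.
    by move=> AB; rewrite -(cut A Al) AB cut.
  - move=> A; rewrite inE => /andP[AI /andP[/eqP Al /forall_inP TI]].
    have Tl : T :&: pts l = T by apply/setIidPl; exact: subset_trans TCl (subsetIr _ _).
    have Bl : (A :|: T) :&: pts l = T by rewrite setIUl Al set0U.
    rewrite inE Bl eqxx andbT; move: (AI); rewrite !inE => /andP[AC /forallP lA].
    apply/andP; split.
      by rewrite subUset AC; apply: subset_trans TCl _; exact: subsetIl.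
    apply/forallP => l'; have [->|ll'] := eqVneq l' l.
      by rewrite setIUl Bl (eqP Fl) setU0 cT.
    have [Tl'|[x]] := set_0Vmem (T :&: pts l').
      by rewrite setIUl setIUl Tl' setU0 -setIUl; exact: lA.
    rewrite inE => /andP[xT xl']; have := TI x xT; rewrite !inE => /andP[_ /forallP/(_ l')].
    apply: leq_trans; apply: subset_leq_card; apply/subsetP => y.
    rewrite !inE => /andP[/orP[/orP[->|yT]|->] yl']; rewrite ?orbT ?yl' //=.
    suff -> : y = x by rewrite eqxx.
    apply/eqP/contraT => yx; move/negP: ll'; case; apply/eqP.
    have /setIP[_ xl] := subsetP TCl _ xT; have /setIP[_ yl] := subsetP TCl _ yT.
    exact: (line_inj plane yl' yl xl' xl yx).
  - move=> A; rewrite inE => /andP[AI /andP[/eqP Al _]]; rewrite /w -exprD.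
    rewrite cardsU cT (_ : A :&: T = set0) ?cards0 ?subn0 //.
    apply/eqP; rewrite -subset0 -Al; apply: setIS.
    by apply: subset_trans TCl _; exact: subsetIr.
apply: le_trans step1; rewrite -mulr_suml ler_pM2r ?exprn_gt0 //.
(* Half of the weight survives: sets meeting [l] cost at most 1/4 by [lam_small], and blocked points
   of [T] cost at most [t * dlt <= 1 / 4]. *)
have step2 : rho <= \sum_(A in I | p A) w A +
    \sum_(x in C :&: pts l) \sum_(A in I | x \in A) w A +
    \sum_(x in T) \sum_(A in I | x |: A \notin I) w A.
  pose p1 (A : {set P}) := [forall x in T, x |: A \in I].
  have h1 : rho <= \sum_(A in I | p1 A) w A +
      \sum_(x in T) \sum_(A in I | x |: A \notin I) w A.
    apply: (@sum_set_cover R _ _ w (mem I) p1 (mem T) (fun x A => x |: A \notin I)) => //.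
    by move=> A AI; rewrite negb_forall_in => /exists_inP.
  apply: le_trans h1 _; rewrite lerD2r.
  have h2 := @sum_set_cover R _ P w [pred A | (A \in I) && p1 A] p
    (mem (C :&: pts l)) (fun x A => x \in A) w0.
  apply: (le_trans (h2 _)).
    move=> A; rewrite inE => /andP[AI p1A]; rewrite /p -/(p1 A) p1A andbT.
    case/set0Pn => x /setIP[xA xl]; exists x => //; apply/setIP; split => //.
    by move: AI; rewrite inE => /andP[/subsetP/(_ _ xA)].
  apply: lerD.
    rewrite [leRHS]big_mkcond [leLHS]big_mkcond; apply: ler_sum => A _ /=.
    by rewrite !inE; case: (_ && load_le _ _ _); case: (p1 A); case: (p A); rewrite /= ?lexx ?w0.
  apply: ler_sum => x _; rewrite [leRHS]big_mkcond [leLHS]big_mkcond.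
  by apply: ler_sum => A _ /=; rewrite !inE; case: (_ && load_le _ _ _);
    case: (p1 A); case: (x \in A); rewrite /= ?lexx ?w0.
have step3 : \sum_(x in C :&: pts l) \sum_(A in I | x \in A) w A <= 1 / 4 * rho.
  apply: (@le_trans _ _ (\sum_(x in C :&: pts l) lam * rho)).
    apply: ler_sum => x _; have := weight_superset lam0 [set x] (@admissible_down C F).
    rewrite cards1 expr1; by under eq_bigl => A do rewrite sub1set.
  rewrite sumr_const -[leLHS]mulr_natl mulrA; apply: ler_wpM2r => //.
  apply: le_trans lam_small; rewrite ler_pM2r //.
  apply: (@le_trans _ _ (\sum_(x in C :&: pts l :\ v) 1 + 1)); last by rewrite lerD2r.
  rewrite sumr_const -[X in _ + X]/(1%:R) -natrD ler_nat.
  by rewrite (cardsD1 v (C :&: pts l)) addnC leq_add2l leq_b1.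
have step4 : \sum_(x in T) \sum_(A in I | x |: A \notin I) w A <= 1 / 4 * rho.
  apply: (@le_trans _ _ (\sum_(x in T) dlt * rho)).
    apply: ler_sum => x xT; apply: free.
    by have /setIP[] := subsetP TCl _ xT.
  by rewrite sumr_const cT -[leLHS]mulr_natl mulrA; apply: ler_wpM2r.
by lra.
Qed.

(** A trace of size [t] on a good line blocks [v]. Each such event has probability at least [a / 2],
    two of them together at most [a ^+ 2], and [a] sums to at least 1/4 over the good lines, so the
    second moment bound applies with [c = 1 / 2]. *)
Lemma good_vertex_blocked v : v \in C -> (q <= 2 * #|good v|)%N ->
  1 / 16 * rho <= \sum_(A in I | v |: A \notin I) w A.
Proof.
move=> vC goodv.
pose h l := initial_subset m (C :&: pts l :\ v).
have hP l : l \in good v -> h l \subset C :&: pts l :\ v /\ #|h l| = m.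
  rewrite inE => /and4P[vl _ ml _]; split; first exact: initial_subset_sub.
  rewrite card_initial_subset // -ltnS; have := cardsD1 v (C :&: pts l).
  by rewrite inE vC vl add1n => <-.
pose D l := [set T : {set P} | (T \subset h l) && (#|T| == t)].
have cD l : l \in good v -> #|D l| = 'C(m, t).
  by move=> /hP[_ hm]; rewrite cards_draws hm.
pose B l A := (A \in I) && (A :&: pts l \in D l).
pose a : R := 'C(m, t)%:R * lam ^+ t.
have a0 : 0 <= a by rewrite mulr_ge0 ?ler0n // exprn_ge0 // ltW.
have -> : 1 / 16 = (1 / 2) / 4 - 1 / 16 :> R by lra.
apply: (@second_moment_bound R _ L w (fun A => (A \in I) && (v |: A \notin I))
  (good v) B (fun=> a)) => //.
- lra.
- rewrite sumr_const -[leRHS]mulr_natl.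
  have : q%:R <= 2 * #|good v|%:R :> R by rewrite -natrM ler_nat.
  have := m_large; rewrite -/a; nra.
- move=> l A lv /andP[AI]; rewrite inE AI => /andP[Ah /eqP At] /=.
  rewrite inE negb_and; apply/orP; right; apply/forallPn; exists l.
  have [hC _] := hP l lv; move: lv; rewrite inE => /and4P[vl _ _ _].
  rewrite -ltnNge -At -[X in (X <= _)%N]add1n.
  have vA : v \notin A :&: pts l.
    by apply/negP => /(subsetP Ah)/(subsetP hC); rewrite !inE eqxx.
  have -> : (1 + #|A :&: pts l| = #|v |: (A :&: pts l)|)%N by rewrite cardsU1 vA.
  apply: subset_leq_card; rewrite subUset sub1set !inE eqxx vl /=.
  by apply/subsetP => y; rewrite !inE => /andP[-> ->]; rewrite orbT.
- move=> l lv.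
  rewrite (partition_big (fun A => A :&: pts l) (mem (D l))) /=; last by move=> A /andP[].
  apply: (@le_trans _ _ (\sum_(T in D l) 1 / 2 * rho * lam ^+ t)).
    by rewrite sumr_const cD // -[leRHS]mulr_natl /a; lra.
  apply: ler_sum => T TD; have [hC _] := hP l lv.
  move: (TD); rewrite inE => /andP[Th /eqP cT].
  apply: le_trans (good_load_ge lv (subset_trans Th hC) cT) _.
  rewrite le_eqVlt; apply/orP; left; apply/eqP; apply: eq_bigl => A.
  by rewrite /B; case: eqP => [->|]; rewrite ?andbF // TD !andbT.
- move=> l l' lv l'v ll'.
  rewrite (partition_big (fun A => A :&: pts l) (mem (D l))) /=; last first.
    by move=> A /andP[/andP[]].
  apply: (@le_trans _ _ (\sum_(T in D l) \sum_(T' in D l') lam ^+ t * lam ^+ t * rho)).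
    apply: ler_sum => T TD.
    rewrite (partition_big (fun A => A :&: pts l') (mem (D l'))) /=; last first.
      by move=> A /andP[/andP[_ /andP[]]].
    apply: ler_sum => T' T'D.
    have [hC _] := hP l lv; have [hC' _] := hP l' l'v.
    move: TD T'D; rewrite !inE => /andP[Th /eqP cT] /andP[T'h /eqP cT'].
    (* Two good lines meet only in [v], which both traces avoid, so the exponents of [lam] add
       up. *)
    have TT' : T :&: T' = set0.
      apply/setP => x; rewrite !inE; apply/negP => /andP[xT xT'].
      have := subsetP hC _ (subsetP Th _ xT); have := subsetP hC' _ (subsetP T'h _ xT').
      move: lv l'v; rewrite !inE => /and4P[vl _ _ _] /and4P[vl' _ _ _].
      case/and3P=> xv _ xl' /and3P[_ _ xl]; move/negP: ll'; case; apply/eqP.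
      exact: (line_inj plane xl xl' vl vl' xv).
    rewrite -exprD -{1}cT -cT' -[(_ + _)%N]subn0 -(cards0 P) -TT' -cardsU.
    apply: le_trans (weight_superset lam0 _ (@admissible_down C F)).
    rewrite [leRHS]big_mkcond [leLHS]big_mkcond; apply: ler_sum => A _.
    rewrite /B -/I; case AI: (A \in I) => //=.
    case: ifP => [|_]; last by case: ifP => // _; exact: w0.
    case/andP=> /andP[_ /eqP <-] /eqP <-.
    by rewrite ifT // subUset !subsetIl.
  rewrite !sumr_const !cD // -[leLHS]mulr_natl -[X in _ * X <= _]mulr_natl /a.
  rewrite le_eqVlt; apply/orP; left; apply/eqP; ring.
Qed.

End Container.

(** If no vertex is blocked with probability above [1 / (8 * t)], this very bound serves as [dlt],
    and the second moment argument yields a vertex blocked with probability 1/16, which is larger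
    since [t >= 3]. *)
Lemma exists_blocked_vertex (R : realFieldType) (P L : finType)
    (pts : L -> {set P}) (q t : nat) (lam : R) (C F : {set P}) (m : nat) :
  affine_plane pts q -> (0 < q)%N -> (3 <= t)%N -> 0 < lam ->
  [disjoint C & F] -> (8 * #|F| <= q)%N ->
  (0 < m)%N -> (8 * (m * q.+1) <= #|C|)%N ->
  (8 * #|C|%:R / q%:R + 1) * lam <= 1 / 4 ->
  1 / 2 <= q%:R * ('C(m, t)%:R * lam ^+ t) ->
  exists2 v, v \in C &
    \sum_(A in admissible pts t C F | v |: A \in admissible pts t C F) lam ^+ #|A|
    <= (1 - 1 / (8 * t%:R)) * \sum_(A in admissible pts t C F) lam ^+ #|A|.
Proof.
move=> plane q0 t3 lam0 CF F_small m0 m_small lam_small m_large.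
set I := admissible pts t C F; set rho := \sum_(A in I) _.
have t0 : 0 < t%:R :> R by rewrite ltr0n (leq_trans _ t3).
pose d : R := 1 / (8 * t%:R).
have splitI v : rho = \sum_(A in I | v |: A \in I) lam ^+ #|A| +
    \sum_(A in I | v |: A \notin I) lam ^+ #|A|.
  by rewrite /rho (bigID (fun A => v |: A \in I)).
have [/exists_inP[v vC vd]|] := boolP [exists v in C,
    d * rho < \sum_(A in I | v |: A \notin I) lam ^+ #|A|].
  by exists v => //; have := splitI v; rewrite -/d; lra.
rewrite negb_exists_in => /forall_inP free0.
have free : {in C, forall x, \sum_(A in I | x |: A \notin I) lam ^+ #|A| <= d * rho}.
  by move=> x /free0; rewrite -leNgt.
have td : t%:R * d = 1 / 8 by rewrite /d; field; rewrite gt_eqF.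
have td4 : t%:R * d <= 1 / 4 by lra.
have d16 : d < 1 / 16.
  rewrite /d ltr_pdivrMr; last by lra.
  have : 3 <= t%:R :> R by rewrite ler_nat.
  by lra.
have [v vC vgood] := exists_rich_vertex R plane q0 CF F_small m0 m_small.
exists v => //.
have blocked := good_vertex_blocked plane lam0 lam_small m_large free td4 vC vgood.
have rho0 : 0 <= rho by apply: sumr_ge0 => A _; rewrite exprn_ge0 // ltW.
have := free v vC; have := splitI v; rewrite -/d.
rewrite -/I -/rho in blocked; nra.
Qed.

(** * Generating functions over subsets *)

Lemma sum_prod_subsets (R : comPzRingType) (T : finType) (f g : T -> R) :
  \sum_(A : {set T}) \prod_x (if x \in A then f x else g x) = \prod_x (f x + g x).
Proof.
pose F x (b : bool) := if b then f x else g x.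
rewrite (eq_bigr (fun x => \sum_(b : bool) F x b)); last first.
  by move=> x _; rewrite big_bool.
rewrite bigA_distr_bigA /= (reindex (fun A : {set T} => [ffun x => x \in A])) /=.
  by apply: eq_bigr => A _; apply: eq_bigr => x _; rewrite ffunE.
exists (fun h : {ffun T -> bool} => [set x | h x]) => [A _|h _].
  by apply/setP => x; rewrite inE ffunE.
by apply/ffunP => x; rewrite ffunE inE.
Qed.

(** Up to normalization, the generating function of a binomial variable, as needed for Chernoff's
    bound. *)
Lemma sum_expr_cardI (R : comPzRingType) (T : finType) (Z : {set T}) (y : R) :
  \sum_(A : {set T}) y ^+ #|A :&: Z| = (y + 1) ^+ #|Z| * 2 ^+ #|~: Z|.
Proof.
transitivity (\prod_(x : T) ((if x \in Z then y else 1) + (1 : R))).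
  rewrite -sum_prod_subsets; apply: eq_bigr => A _.
  rewrite -prodr_const big_mkcond /=; apply: eq_bigr => x _.
  by rewrite inE; case: (x \in A); case: (x \in Z).
rewrite (bigID [in Z]) /=; congr (_ * _).
  by rewrite -prodr_const; apply: eq_bigr => x ->.
rewrite (eq_bigl [in ~: Z]) => [|x]; last by rewrite inE.
by rewrite -prodr_const; apply: eq_bigr => x; rewrite inE => /negPf ->.
Qed.

Lemma sum_expr_subset (R : realFieldType) (T : finType) (C : {set T}) (y : R) :
  \sum_(A : {set T} | A \subset C) y ^+ #|A| = (y + 1) ^+ #|C|.
Proof.
transitivity (\prod_(x : T) ((if x \in C then y else 0) + (1 : R))).
  rewrite -sum_prod_subsets big_mkcond /=; apply: eq_bigr => A _.
  rewrite -prodr_const; have [AC|/subsetPn[x xA xC]] := boolP (A \subset C).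
    rewrite big_mkcond /=; apply: eq_bigr => x _.
    by case: ifP => // xA; rewrite (subsetP AC).
  by rewrite (bigD1 x) //= xA (negPf xC) mul0r.
rewrite (bigID [in C]) /= [X in _ * X]big1 ?mulr1.
  by rewrite -prodr_const; apply: eq_bigr => x ->.
by move=> x /negPf ->; rewrite add0r.
Qed.

(** * Containers *)

Section DecisionTree.
Variables (R : realFieldType) (P L : finType) (pts : L -> {set P}) (t : nat).
Variables (lam d : R) (fmax smin smax : nat).
Hypotheses (lam0 : 0 < lam) (d1 : d <= 1).

Let rho (C F : {set P}) : R := \sum_(A in admissible pts t C F) lam ^+ #|A|.

Hypothesis blocked_vertex : forall C F : {set P}, [disjoint C & F] -> (#|F| <= fmax)%N ->
  (smin < #|C| <= smax)%N -> exists2 v, v \in C &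
    \sum_(A in admissible pts t C F | v |: A \in admissible pts t C F) lam ^+ #|A|
    <= (1 - d) * rho C F.

Lemma disjointU1r (C F : {set P}) v :
  [disjoint C & F] -> [disjoint C :\ v & v |: F].
Proof.
move=> CF; rewrite -setI_eq0; apply/eqP/setP => x; rewrite !inE.
by case: eqP => //= _; apply/negP => /andP[/(disjointFr CF)->].
Qed.

(* Querying a vertex [v] that is rarely free: a negative answer deletes [v] from
   the container, a positive one adds [v] to the fingerprint and decreases the
   partition function by the factor [1 - d]. *)
Lemma decision_tree k (C F : {set P}) : [disjoint C & F] -> (#|C| <= smax)%N ->
  (#|F| + k <= fmax)%N -> rho C F * (1 - d) ^+ k < 1 ->
  exists cs : seq ({set P} * {set P}), [/\ (size cs <= #|C|.+1 ^ k)%N,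
    {in cs, forall c : {set P} * {set P}, [/\ (#|c.1| <= #|F| + k)%N, (#|c.2| <= smin)%N &
      [disjoint c.2 & c.1]]}
    & forall Q, load_le pts t Q -> F \subset Q -> Q \subset F :|: C ->
      exists2 c, c \in cs & c.1 \subset Q /\ Q \subset c.1 :|: c.2].
Proof.
move: {2}#|C| (leqnn #|C|) => n; elim: n k C F => [|n IHn] k C F.
all: move=> Cn CF Cmax Fk rho_small.
all: have [Csmall|Cbig] := leqP #|C| smin.
all: try by exists [:: (F, C)]; split => [|c|Q _ FQ QF]; rewrite ?expn_gt0 //;
  [rewrite inE => /eqP -> /=; split; rewrite ?leq_addr
  |exists (F, C); rewrite ?inE].
  by move: (leq_trans Cbig Cn).
have [F_le|F_big] := boolP (load_le pts t F); last first.
  exists [::]; split=> // Q Qt FQ _; case/negP: F_big.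
  exact: load_le_sub FQ Qt.
(* The empty set alone has weight 1, so the bound on [rho] rules out [k = 0]: the positive answers
   cannot run out here. *)
have rho1 : 1 <= rho C F.
  rewrite /rho (bigD1 set0) /=; last by rewrite inE sub0set set0U.
  by rewrite cards0 expr0 lerDl sumr_ge0 // => A _; rewrite exprn_ge0 // ltW.
case: k Fk rho_small => [|k] Fk rho_small; first by move: rho_small; rewrite expr0; lra.
have Fmax : (#|F| <= fmax)%N by apply: leq_trans Fk; exact: leq_addr.
have Csize : (smin < #|C| <= smax)%N by rewrite Cbig.
have [v vC v_free] := blocked_vertex CF Fmax Csize.
have cardC : #|C| = #|C :\ v|.+1 by rewrite (cardsD1 v) vC.
have vF : v \notin F by rewrite (disjointFr CF vC).
have Cn' : (#|C :\ v| <= n)%N by rewrite -ltnS -cardC.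
have Cmax' : (#|C :\ v| <= smax)%N by apply: leq_trans Cmax; rewrite cardC.
have lamX A : 0 <= lam ^+ #|A : {set P}| by rewrite exprn_ge0 // ltW.
have d0 : 0 <= 1 - d by rewrite subr_ge0.
have [||cs0 [size0 bound0 cover0]] := IHn k.+1 _ F Cn' _ Cmax' Fk.
- by apply: disjointWl CF; exact: subD1set.
- apply: le_lt_trans rho_small; rewrite ler_wpM2r ?exprn_ge0 //.
  rewrite /rho [leRHS]big_mkcond [leLHS]big_mkcond; apply: ler_sum => A _.
  rewrite !inE subsetD1; case: (A \subset C); case: (v \in A); case: load_le => //=.
have [||cs1 [size1 bound1 cover1]] := IHn k _ (v |: F) Cn' (disjointU1r v CF) Cmax'.
- by rewrite cardsU1 vF add1n addSnnS.
- apply: le_lt_trans rho_small; rewrite exprS mulrCA mulrA ler_wpM2r ?exprn_ge0 //.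
  rewrite mulrC in v_free.
  rewrite mulrC; apply: le_trans (le_trans v_free _); last by rewrite mulrC.
  rewrite /rho [leRHS]big_mkcond [leLHS]big_mkcond; apply: ler_sum => A _.
  case: ifP => [|_]; last by case: ifP.
  rewrite !inE subsetD1 => /andP[/andP[AC _] lA].
  rewrite subUset sub1set vC AC /= -setUA setUCA lA /=.
  by rewrite (load_le_sub _ lA) ?lexx // setUCA subsetUr.
exists (cs0 ++ cs1); split.
(* With [c] points in [C :\ v]: (c + 1)^(k + 1) + (c + 1)^k = (c + 1)^k (c + 2) <= (c + 2)^(k +
   1). *)
- rewrite size_cat cardC; apply: (leq_trans (leq_add size0 size1)).
  rewrite expnSr -[X in (_ + X <= _)%N]muln1 -mulnDr addn1 expnSr.
  rewrite leq_mul2r; apply/orP; right.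
  by have [->|k0] := posnP k; rewrite ?expn0 // leq_exp2r.
- move=> c; rewrite mem_cat => /orP[/bound0 //|/bound1[c1 c2 c3]]; split=> //.
  by move: c1; rewrite cardsU1 vF add1n addSnnS.
move=> Q Qt FQ QFC; have [vQ|vQ] := boolP (v \in Q).
  have [||c cin cQ] := cover1 Q Qt.
  - by rewrite subUset sub1set vQ.
  - apply: subset_trans QFC _; apply/subsetP => x; rewrite !inE.
    by case: eqP => //= _; case: (x \in F).
  by exists c => //; rewrite mem_cat cin orbT.
have [|c cin cQ] := cover0 Q Qt FQ.
  apply/subsetP => x xQ; have := subsetP QFC x xQ; rewrite !inE => /orP[->//|->].
  by rewrite orbC andbT; apply/orP; left; apply: contraNneq vQ => <-.
by exists c => //; rewrite mem_cat cin.
Qed.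

End DecisionTree.

Lemma leq_exp_ffact t m : ((m - t) ^ t <= m ^_ t)%N.
Proof.
elim: t m => [|t IHt] [|m] //; first by rewrite sub0n exp0n.
by rewrite ffactSS subSS expnS leq_mul // (leq_trans (leq_subr _ _)).
Qed.

Lemma ffact_leq_exp t m : (m ^_ t <= m ^ t)%N.
Proof.
elim: t m => [|t IHt] [|m] //; rewrite ffactSS expnS leq_mul //.
by apply: leq_trans (IHt m) _; case: t {IHt} => // t; rewrite leq_exp2r.
Qed.

(** Combine [m <= 2 * (m - t)], the bound (m - t)^t for the falling factorial, and t! <= t^t. *)
Lemma exp_leq_bin t m : (2 * t <= m -> m ^ t <= (2 * t) ^ t * 'C(m, t))%N.
Proof.
move=> tm; case: t tm => [|t] tm; first by rewrite bin0.
apply: (@leq_trans ((2 * (m - t.+1)) ^ t.+1)); first by rewrite leq_exp2r //; lia.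
rewrite !expnMn -mulnA leq_pmul2l ?expn_gt0 //.
apply: (leq_trans (leq_exp_ffact t.+1 m)); rewrite -bin_ffact mulnC leq_mul //.
by rewrite -ffactnn ffact_leq_exp.
Qed.

(** The fugacity [2 ^+ i / (B * q)] is scaled to a container of about [q ^ 2 / 2 ^ i] points. Then
    [lam_small] becomes 9 / B <= 1 / 4, whence the 36, and [m_large] follows from
    ['C(m, t) * lam ^+ t] being at least (128 B t)^(-t). *)
Lemma blocked_vertex_at_scale (R : realFieldType) (P L : finType)
    (pts : L -> {set P}) (q t B i : nat) (C F : {set P}) :
  affine_plane pts q -> (0 < q)%N -> (3 <= t)%N -> (36 <= B)%N ->
  (2 ^ (i + 5) * (2 * t) <= q)%N -> ((128 * B * t) ^ t <= q)%N ->
  [disjoint C & F] -> (8 * #|F| <= q)%N ->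
  (q * q < 2 ^ i.+1 * #|C|)%N -> (2 ^ i * #|C| <= q * q)%N ->
  exists2 v, v \in C &
    \sum_(A in admissible pts t C F | v |: A \in admissible pts t C F)
      (2 ^+ i / (B%:R * q%:R) : R) ^+ #|A|
    <= (1 - 1 / (8 * t%:R)) *
      \sum_(A in admissible pts t C F) (2 ^+ i / (B%:R * q%:R)) ^+ #|A|.
Proof.
move=> plane q_gt0 t3 B36 it_q Bt_q CF F_small C_large C_small.
have t_gt0 : (0 < t)%N by exact: leq_trans t3.
have B0 : 0 < B%:R :> R by rewrite ltr0n (leq_trans _ B36).
have B36' : 36 <= B%:R :> R by rewrite ler_nat.
have q0 : 0 < q%:R :> R by rewrite ltr0n.
have i0 : 0 < 2 ^+ i :> R by rewrite exprn_gt0.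
have p2 : (0 < 2 ^ (i + 5))%N by rewrite expn_gt0.
(* The shift 5 makes [8 * m * (q + 1)] at most [16 * m * q], hence at most [q ^ 2 / 2 ^ (i + 1)],
   which is below the size of [C]. *)
pose m := (q %/ 2 ^ (i + 5))%N.
have tm : (2 * t <= m)%N by rewrite leq_divRL // mulnC.
have m_gt0 : (0 < m)%N by apply: leq_trans tm; rewrite muln_gt0.
have mq : (m * 2 ^ (i + 5) <= q)%N by exact: leq_trunc_div.
have qm : (q <= 2 * m * 2 ^ (i + 5))%N.
  have : (q < m.+1 * 2 ^ (i + 5))%N by rewrite ltn_ceil.
  by move=> /ltnW h; apply: leq_trans h _; rewrite leq_mul2r; apply/orP; right; lia.
have e5 : (2 ^ (i + 5) = 32 * 2 ^ i)%N by rewrite expnD mulnC.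
apply: (@exists_blocked_vertex R P L pts q t _ C F m) => //.
- by rewrite divr_gt0 // mulr_gt0.
- move: mq C_large; rewrite e5 expnS => mq C_large.
  rewrite -(leq_pmul2l (_ : 0 < 2 * 2 ^ i)%N); last by rewrite muln_gt0 expn_gt0.
  apply: leq_trans (ltnW C_large).
  apply: (@leq_trans (m * (32 * 2 ^ i) * q)); last by rewrite leq_mul2r mq orbT.
  have -> : (m * (32 * 2 ^ i) * q = 2 * 2 ^ i * (8 * (m * (2 * q))))%N by lia.
  by rewrite !leq_mul2l; do 3! (apply/orP; right); lia.
- have h : 2 ^+ i * #|C|%:R <= q%:R * q%:R :> R by rewrite -natrX -!natrM ler_nat.
  have h' : 2 ^+ i <= q%:R :> R.
    rewrite -natrX ler_nat; apply: leq_trans it_q; rewrite e5.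
    by rewrite -mulnA mulnCA -[X in (X <= _)%N]muln1 leq_mul2l; apply/orP; right; lia.
  have -> : (8 * #|C|%:R / q%:R + 1) * (2 ^+ i / (B%:R * q%:R)) =
      (8 * (2 ^+ i * #|C|%:R) / q%:R + 2 ^+ i) / (B%:R * q%:R) :> R.
    by field; rewrite !gt_eqF.
  rewrite ler_pdivrMr ?mulr_gt0 //.
  apply: (@le_trans _ _ (8 * q%:R + q%:R)); last by nra.
  apply: lerD => //; rewrite -mulrA ler_pM2l // ler_pdivrMr //.
- have lam_m : (128 * B%:R * t%:R)^-1 <=
      m%:R / (2 * t%:R) * (2 ^+ i / (B%:R * q%:R)) :> R.
    have t0 : 0 < t%:R :> R by rewrite ltr0n.
    have -> : m%:R / (2 * t%:R) * (2 ^+ i / (B%:R * q%:R)) =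
        (64 * 2 ^+ i * m%:R / q%:R) * (128 * B%:R * t%:R)^-1 :> R.
      by field; rewrite !gt_eqF.
    rewrite ler_peMl ?invr_ge0 ?mulr_ge0 ?ler0n // ler_pdivlMr // mul1r.
    have : (q <= 64 * 2 ^ i * m)%N by move: qm; rewrite e5; lia.
    by rewrite -(ler_nat R) !natrM natrX.
  have t0 : 0 < t%:R :> R by rewrite ltr0n.
  have D0 : 0 < 128 * B%:R * t%:R :> R by rewrite !mulr_gt0.
  have h1 : (m%:R / (2 * t%:R)) ^+ t <= 'C(m, t)%:R :> R.
    rewrite exprMn exprVn ler_pdivrMr ?exprn_gt0 ?mulr_gt0 //.
    by rewrite mulrC -!natrM -!natrX -natrM ler_nat; exact: exp_leq_bin.
  have h2 : (128 * B%:R * t%:R)^-1 ^+ t <=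
      'C(m, t)%:R * (2 ^+ i / (B%:R * q%:R)) ^+ t :> R.
    apply: (@le_trans _ _ ((m%:R / (2 * t%:R) * (2 ^+ i / (B%:R * q%:R))) ^+ t)).
      have inv0 : 0 <= (128 * B%:R * t%:R)^-1 :> R by rewrite invr_ge0 ltW.
      by apply: lerXn2r; rewrite ?nnegrE ?(le_trans inv0 lam_m).
    rewrite exprMn ler_wpM2r // exprn_ge0 // ltW // divr_gt0 // mulr_gt0 //.
  apply: (@le_trans _ _ (q%:R * (128 * B%:R * t%:R)^-1 ^+ t)); last by rewrite ler_pM2l.
  apply: (@le_trans _ _ 1); first by lra.
  rewrite exprVn ler_pdivlMr ?exprn_gt0 // mul1r.
  by rewrite -!natrM -natrX ler_nat.
Qed.

Lemma sum_admissible_le (R : realType) (P L : finType) (pts : L -> {set P}) t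
    (lam : R) (C F : {set P}) : 0 < lam ->
  \sum_(A in admissible pts t C F) lam ^+ #|A| <= expR (lam * #|C|%:R).
Proof.
move=> lam0; apply: (@le_trans _ _ ((lam + 1) ^+ #|C|)).
  rewrite -sum_expr_subset [leRHS]big_mkcond [leLHS]big_mkcond.
  apply: ler_sum => A _; rewrite inE; case: (A \subset C) => //=.
  by case: ifP => // _; rewrite exprn_ge0 // ltW.
rewrite mulrC expRM_natl; apply: lerXn2r; rewrite ?nnegrE ?expR_ge0 //.
  by rewrite addr_ge0 // ltW.
by rewrite addrC expR_ge1Dx.
Qed.

Section Containers.
Variables (R : realType) (P L : finType) (pts : L -> {set P}) (q t B k : nat).
Hypothesis plane : affine_plane pts q.
Hypotheses (q_gt0 : (0 < q)%N) (t3 : (3 <= t)%N) (B36 : (36 <= B)%N).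
Hypothesis Bt_q : ((128 * B * t) ^ t <= q)%N.
Hypothesis k_large : (8 * t * q < k * B)%N.

(** A pair consists of a fingerprint and the container that remains. *)
Definition covers (cs : seq ({set P} * {set P})) (Q : {set P}) :=
  exists2 c, c \in cs & c.1 \subset Q /\ Q \subset c.1 :|: c.2.

(** One phase halves the bound on the container. The partition function starts below exp(q / B), and
    [k] positive answers multiply it by at most exp(- k / (8 t)), so [k_large] brings it below 1. *)
Lemma container_refine i (C F : {set P}) : [disjoint C & F] ->
  (2 ^ (i + 5) * (2 * t) <= q)%N -> (8 * (#|F| + k) <= q)%N ->
  (2 ^ i * #|C| <= q * q)%N ->
  exists cs, [/\ (size cs <= (q * q).+1 ^ k)%N,
    {in cs, forall c : {set P} * {set P}, [/\ (#|c.1| <= #|F| + k)%N,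
      (2 ^ i.+1 * #|c.2| <= q * q)%N & [disjoint c.2 & c.1]]}
    & forall Q, load_le pts t Q -> F \subset Q -> Q \subset F :|: C -> covers cs Q].
Proof.
move=> CF it_q F_small C_small.
pose lam : R := 2 ^+ i / (B%:R * q%:R).
pose d : R := 1 / (8 * t%:R).
have B0 : 0 < B%:R :> R by rewrite ltr0n (leq_trans _ B36).
have q0 : 0 < q%:R :> R by rewrite ltr0n.
have t0 : 0 < t%:R :> R by rewrite ltr0n (leq_trans _ t3).
have lam0 : 0 < lam by rewrite divr_gt0 ?mulr_gt0 ?exprn_gt0.
have d1 : d <= 1.
  rewrite /d ler_pdivrMr ?mulr_gt0 // mul1r -natrM ler1n muln_gt0 /=.
  exact: leq_trans t3.
have p2 j : (0 < 2 ^ j)%N by rewrite expn_gt0.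
have [||||cs [size_cs cs_bound cs_cover]] :=
  @decision_tree R P L pts t lam d (q %/ 8) (q * q %/ 2 ^ i.+1) (q * q %/ 2 ^ i)
    lam0 d1 _ k C F CF.
- move=> C' F' CF' F'_small /andP[C'_large C'_small].
  apply: (@blocked_vertex_at_scale R P L pts q t B i C' F') => //.
  + by move: F'_small; rewrite leq_divRL // mulnC.
  + by move: C'_large; rewrite ltn_divLR // mulnC.
  + by move: C'_small; rewrite leq_divRL // mulnC.
- by rewrite leq_divRL // mulnC.
- by rewrite leq_divRL // mulnC.
- apply: (@le_lt_trans _ _ (expR (lam * #|C|%:R) * expR (- d) ^+ k)).
    apply: ler_pM; rewrite ?sumr_ge0 ?exprn_ge0 ?subr_ge0 //.
    + by move=> A _; rewrite exprn_ge0 // ltW.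
    + exact: sum_admissible_le.
    + by apply: lerXn2r; rewrite ?nnegrE ?expR_ge0 ?subr_ge0 // expR_ge1Dx.
  rewrite -expRM_natl -expRD -[ltRHS]expR0 ltr_expR mulrN subr_lt0.
  have C_q : 2 ^+ i * #|C|%:R <= q%:R * q%:R :> R by rewrite -natrX -!natrM ler_nat.
  apply: (@le_lt_trans _ _ (q%:R / B%:R)).
    have -> : lam * #|C|%:R = (2 ^+ i * #|C|%:R) / q%:R / B%:R.
      by rewrite /lam; field; rewrite !gt_eqF.
    by rewrite ler_pM2r ?invr_gt0 // ler_pdivrMr.
  rewrite /d mulrA mulr1 ltr_pdivlMr ?mulr_gt0 // mulrAC ltr_pdivrMr //.
  by rewrite mulrC -!natrM ltr_nat.
exists cs; split=> //.
- apply: (leq_trans size_cs); have [->//|k_gt0] := posnP k.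
  rewrite leq_exp2r // ltnS; apply: leq_trans C_small.
  by rewrite leq_pmull.
- move=> c /cs_bound[c1 c2 c3]; split=> //.
  by move: c2; rewrite leq_divRL // mulnC.
Qed.

(** Iterate [i] phases from the whole plane; each adds at most [k] points to a fingerprint. *)
Lemma container_family i : (8 * (i * k) <= q)%N ->
  (2 ^ (i + 4) * (2 * t) <= q)%N ->
  exists cs, [/\ (size cs <= ((q * q).+1 ^ k) ^ i)%N,
    {in cs, forall c : {set P} * {set P}, [/\ (8 * #|c.1| <= q)%N,
      (2 ^ i * #|c.2| <= q * q)%N & [disjoint c.2 & c.1]]}
    & forall Q, load_le pts t Q -> covers cs Q].
Proof.
have [cP _ _ _] := plane.
move=> ik it_q; suff [cs [cs1 cs2 cs3]] : exists cs,
   [/\ (size cs <= ((q * q).+1 ^ k) ^ i)%N,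
    {in cs, forall c : {set P} * {set P}, [/\ (#|c.1| <= i * k)%N,
      (2 ^ i * #|c.2| <= q * q)%N & [disjoint c.2 & c.1]]}
    & forall Q, load_le pts t Q -> covers cs Q].
  exists cs; split=> // c /cs2[c1 c2 c3]; split=> //.
  by apply: leq_trans ik; rewrite leq_mul2l.
elim: i ik it_q => [|i IHi] ik it_q.
  exists [:: (set0, setT)]; split=> // [c|Q _].
    by rewrite inE => /eqP -> /=; rewrite cards0 cardsT cP mul1n -setI_eq0 setI0.
  by exists (set0, setT); rewrite ?inE //= sub0set set0U subsetT.
have [||cs [size_cs cs_bound cs_cover]] := IHi.
- by apply: leq_trans ik; rewrite !leq_mul2l leq_mul2r leqnSn !orbT.
- apply: leq_trans it_q; rewrite leq_mul2r; apply/orP; right.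
  by rewrite leq_exp2l // leq_add2r.
(* Every pair of the previous family is refined separately and the resulting lists are
   concatenated. *)
suff [cs' [size_cs' cs'_bound cs'_cover]] : exists cs',
    [/\ (size cs' <= size cs * (q * q).+1 ^ k)%N,
    {in cs', forall c : {set P} * {set P}, [/\ (#|c.1| <= i.+1 * k)%N,
      (2 ^ i.+1 * #|c.2| <= q * q)%N & [disjoint c.2 & c.1]]}
    & forall Q, load_le pts t Q -> covers cs Q -> covers cs' Q].
  exists cs'; split=> // [|Q Qt]; last exact/cs'_cover/cs_cover.
  by apply: (leq_trans size_cs'); rewrite expnSr leq_mul2r size_cs orbT.
elim: cs cs_bound {size_cs cs_cover} => [|[F C] cs IHcs] cs_bound.
  by exists [::]; split=> // Q _ [].
have [|cs2 [size2 bound2 cover2]] := IHcs.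
  by move=> c c_cs; apply: cs_bound; rewrite inE c_cs orbT.
have [/= F_i C_i CF] := cs_bound (F, C) (mem_head _ _).
have [||cs1 [size1 bound1 cover1]] := container_refine CF _ _ C_i.
- by apply: leq_trans it_q; rewrite addnS addSn.
- apply: leq_trans ik; rewrite leq_mul2l mulSn addnC leq_add2l F_i orbT //.
exists (cs1 ++ cs2); split.
- by rewrite size_cat /= mulSn leq_add.
- move=> c; rewrite mem_cat => /orP[/bound1[c1 c2 c3]|/bound2 //]; split=> //.
  by apply: leq_trans c1 _; rewrite mulSn addnC leq_add2l.
- move=> Q Qt [c]; rewrite inE => /orP[/eqP -> /= [FQ QF]|c_cs cQ].
    by have [c' c'_in c'Q] := cover1 Q Qt FQ QF; exists c'; rewrite // mem_cat c'_in.
  have [|c' c'_in c'Q] := cover2 Q Qt; first by exists c.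
  by exists c'; rewrite // mem_cat c'_in orbT.
Qed.

End Containers.

(** * Sets sparing the traces of all lines *)

Section DownClosedCounting.
Variables (R : realFieldType) (P : finType) (I : {set {set P}}).
Hypothesis dI : down_closed I.
Let N : R := \sum_(D in I) 1.

(** Exchanging [X] for any of its subsets [U] maps the sets containing [X] injectively to those with
    trace [U]. *)
Lemma count_superset (X : {set P}) :
  \sum_(D in I | X \subset D) 1 <= 2 ^- #|X| * N.
Proof.
rewrite mulrC ler_pdivlMr ?exprn_gt0 // mulrC.
have -> : N = \sum_(U in powerset X) \sum_(D in I | D :&: X == U) (1 : R).
  rewrite /N (partition_big (fun D => D :&: X) (mem (powerset X))) //.
  by move=> D _ /=; rewrite powersetE subsetIr.
rewrite -natrX -card_powerset mulr_natl -sumr_const; apply: ler_sum => U.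
rewrite powersetE => UX.
apply: (@ler_sum_inj R _ _ [pred D | (D \in I) && (X \subset D)]
  [pred D | (D \in I) && (D :&: X == U)] (fun D => (D :\: X) :|: U)) => //.
- move=> A B; rewrite !inE => /andP[_ XA] /andP[_ XB] AB.
  have UX0 : U :\: X = set0 by apply/eqP; rewrite setD_eq0.
  have cut (D : {set P}) : ((D :\: X) :|: U) :\: X = D :\: X.
    by rewrite setDUl UX0 setU0 setDDl setUid.
  by rewrite -(setID A X) -(setID B X) (setIidPr XA) (setIidPr XB) -cut AB cut.
- move=> D; rewrite !inE => /andP[DI XD]; apply/andP; split.
    by apply: (dI DI); rewrite subUset subsetDl (subset_trans UX XD).
  rewrite setIUl (setIidPl UX) (_ : (D :\: X) :&: X = set0) ?set0U //.
  by apply/setP => x; rewrite !inE; case: (x \in X); rewrite ?andbF.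
Qed.

(** Removing [v] pairs the sets containing it with sets that avoid [v] and for which [v] is free;
    blocked sets stay unpaired. *)
Lemma count_mem_free v :
  2 * \sum_(D in I | v \in D) 1 <= N - \sum_(D in I | v |: D \notin I) 1.
Proof.
have -> : N = \sum_(D in I | v \in D) 1 + \sum_(D in I | v \notin D) 1.
  by rewrite /N (bigID (fun D : {set P} => v \in D)).
rewrite mulr_natl mulr2n -addrA lerD2l lerBrDr.
rewrite [leRHS](bigID (fun D : {set P} => v |: D \in I)) /= [leLHS]addrC [leRHS]addrC.
apply: lerD; last first.
  apply: (@ler_sum_inj R _ _ [pred D | (D \in I) && (v \in D)]
    [pred D | (D \in I) && (v \notin D) && (v |: D \in I)] (fun D => D :\ v)) => //.
    move=> A B; rewrite !inE => /andP[_ vA] /andP[_ vB] AB.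
    by rewrite -(setD1K vA) -(setD1K vB) AB.
  move=> D; rewrite !inE => /andP[DI vD]; rewrite setD1K // DI eqxx /= !andbT.
  by apply: (dI DI); exact: subD1set.
rewrite [leRHS]big_mkcond [leLHS]big_mkcond; apply: ler_sum => D _.
case DI: (D \in I) => //=; case vD: (v \in D) => //=.
by rewrite (setUidPr _) ?DI // sub1set.
Qed.

End DownClosedCounting.

Section Sparing.
Variables (R : realFieldType) (P L : finType) (pts : L -> {set P}) (q : nat).
Hypothesis plane : affine_plane pts q.
Hypothesis q_gt0 : (0 < q)%N.
Variables F Z : {set P}.
Hypothesis ZF : [disjoint Z & F].
Hypothesis F_small : (8 * #|F| <= q)%N.

(** [D] stands for the complement of [S]: if it contains the trace on [Z] of a line missing [F],
    then [F :|: (Z :&: S)] misses that line. *)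
Definition sparing : {set {set P}} :=
  [set D : {set P} |
    [forall l, (F :&: pts l == set0) ==> ~~ (Z :&: pts l \subset D)]].

Lemma sparing_down : down_closed sparing.
Proof.
move=> A B; rewrite !inE => /forallP IA BA; apply/forallP => l; apply/implyP => Fl.
by have /implyP/(_ Fl) := IA l; apply: contra => /subset_trans; apply.
Qed.

Let N : R := \sum_(D in sparing) 1.
Let nf v : R := \sum_(D in sparing | v |: D \notin sparing) 1.
Let nf0 v : 0 <= nf v. Proof. by apply: sumr_ge0. Qed.
Hypothesis N0 : 0 < N.
Hypothesis nf_small : \sum_(v in Z) nf v <= q%:R / 64 * N.

Let q0 : 0 < q%:R :> R. Proof. by rewrite ltr0n. Qed.

Let good v := [set l | [&& v \in pts l, F :&: pts l == set0,
   \sum_(x in Z :&: pts l :\ v) (1 : R) <= 8 * #|Z|%:R / q%:R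
   & \sum_(x in Z :&: pts l :\ v) nf x <= N / 8]].

(** Each of the three defects excludes at most [q / 8] lines; for the blocking weight this is
    Markov's inequality with [nf_small], an assumption refuted later. *)
Lemma card_sparing_good v : v \in Z -> (q <= 2 * #|good v|)%N.
Proof.
have [cP cl deg _] := plane.
move=> vZ; have vF : v \notin F by rewrite (disjointFr ZF vZ).
pose hit := [set l | (v \in pts l) && (F :&: pts l != set0)].
pose big := [set l | (v \in pts l) &&
   (8 * #|Z|%:R / q%:R < \sum_(x in Z :&: pts l :\ v) (1 : R))].
pose tight := [set l | (v \in pts l) && (N / 8 < \sum_(x in Z :&: pts l :\ v) nf x)].
have hitF : (8 * #|hit| <= q)%N.
  by apply: leq_trans F_small; rewrite leq_mul2l /=; exact: (card_pencil_hit plane vF).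
have c0 : 0 < #|Z|%:R :> R by rewrite ltr0n; apply/card_gt0P; exists v.
have bigC : (8 * #|big| <= q)%N.
  have a0 : 0 < 8 * #|Z|%:R / q%:R :> R by rewrite divr_gt0 // mulr_gt0.
  have := card_pencil_markov plane v Z a0 (fun=> ler01).
  rewrite sumr_const -/big mulrAC ler_pdivrMr // [8 * _]mulrC -mulrA ler_pM2l //.
  by rewrite -natrM ler_nat.
have tightC : (8 * #|tight| <= q)%N.
  have a0 : 0 < N / 8 by rewrite divr_gt0.
  have := le_trans (card_pencil_markov plane v Z a0 nf0) nf_small.
  rewrite -/tight [N / 8]mulrC mulrAC ler_pM2r // -(ler_nat R) natrM; lra.
have cover : [set l | v \in pts l] \subset good v :|: hit :|: big :|: tight.
  apply/subsetP => l; rewrite !inE => vl; rewrite vl /= !ltNge.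
  case: (F :&: pts l == set0) => //=.
  case: (\sum_(x in Z :&: pts l :\ v) (1 : R) <= _) => //=.
  by case: (\sum_(x in Z :&: pts l :\ v) nf x <= _); rewrite ?orbT.
have := subset_leq_card cover; rewrite deg.
have := (leq_card_setU (good v :|: hit :|: big) tight).1.
have := (leq_card_setU (good v :|: hit) big).1.
have := (leq_card_setU (good v) hit).1.
lia.
Qed.

(** At least [N / 2] sparing sets avoid [v], and at most [N / 8] of them have a blocked point in the
    trace [T] of [l] without [v]. Adding [T] to the others is at most [2 ^ #|T|] to one and keeps
    them sparing: [v] protects [l], and any other line meets [T] in at most one point, which is
    free. *)
Lemma sparing_load_ge v l : v \in Z -> l \in good v ->
  3 / 8 * 2 ^- #|Z :&: pts l :\ v| * N <=
  \sum_(D in sparing | (v \notin D) && (Z :&: pts l :\ v \subset D)) 1.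
Proof.
move=> vZ; rewrite inE => /and4P[vl Fl _ tight].
set T := Z :&: pts l :\ v.
pose p (D : {set P}) := [forall x in T, x |: D \in sparing].
have vT : v \notin T by rewrite !inE eqxx.
have step1 : \sum_(D | (D \in sparing) && (v \notin D) && p D) (1 : R) <=
    2 ^+ #|T| * \sum_(D in sparing | (v \notin D) && (T \subset D)) 1.
  rewrite (partition_big (fun D => D :&: T) (mem (powerset T))) /=; last first.
    by move=> D _ /=; rewrite powersetE subsetIr.
  rewrite -natrX -card_powerset mulr_natl -sumr_const; apply: ler_sum => V _.
  apply: (@ler_sum_inj R _ _
    [pred D | (D \in sparing) && (v \notin D) && p D && (D :&: T == V)]
    [pred D | (D \in sparing) && ((v \notin D) && (T \subset D))]
    (fun D => D :|: T)) => //.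
  - move=> A B; rewrite !inE => /andP[_ /eqP AV] /andP[_ /eqP BV] AB.
    have cut (D : {set P}) : (D :|: T) :\: T = D :\: T by rewrite setDUl setDv setU0.
    by rewrite -(setID A T) -(setID B T) AV BV -cut AB cut.
  move=> D; rewrite inE => /andP[/andP[/andP[DI vD] /forall_inP pD] _].
  rewrite inE subsetUr andbT; apply/andP; split; last by rewrite inE negb_or vD.
  rewrite inE; apply/forallP => l'; apply/implyP => Fl'.
  apply/negP => Zl'; have [ll'|ll'] := eqVneq l' l.
    have : v \in D :|: T by apply: (subsetP Zl'); rewrite inE vZ ll'.
    by rewrite inE (negPf vD) (negPf vT).
  have [Tl'|[x]] := set_0Vmem (T :&: pts l').
    move: DI; rewrite inE => /forallP/(_ l'); rewrite Fl' /= => /negP; apply.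
    apply/subsetP => y yl'; have := subsetP Zl' y yl'; rewrite inE => /orP[//|yT].
    have : y \in T :&: pts l' by rewrite inE yT; case/setIP: yl'.
    by rewrite Tl' inE.
  rewrite inE => /andP[xT xl'].
  have := pD x xT; rewrite inE => /forallP/(_ l'); rewrite Fl' /= => /negP; apply.
  apply/subsetP => y yl'; have := subsetP Zl' y yl'; rewrite !inE => /orP[->|yT].
    by rewrite orbT.
  suff -> : y = x by rewrite eqxx.
  apply/eqP/contraT => yx; move/negP: ll'; case; apply/eqP.
  move: xT yT yl'; rewrite !inE => /and3P[_ _ xl] /and3P[_ _ yl] /andP[_ yl'].
  exact: (line_inj plane yl' yl xl' xl yx).
have step2 : 1 / 2 * N <= \sum_(D in sparing | v \notin D) 1.
  have NE : N = \sum_(D in sparing | v \in D) 1 + \sum_(D in sparing | v \notin D) 1.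
    by rewrite /N (bigID (fun D : {set P} => v \in D)).
  have := count_mem_free R sparing_down v; rewrite -/N -/(nf v); move: (nf0 v) NE; lra.
have step3 : \sum_(D in sparing | v \notin D) 1 <=
    \sum_(D | (D \in sparing) && (v \notin D) && p D) 1 + \sum_(x in T) nf x.
  have h := @sum_set_cover R {set P} P (fun=> 1)
    [pred D | (D \in sparing) && (v \notin D)] p (mem T)
    (fun x D => x |: D \notin sparing) (fun=> ler01).
  apply: le_trans (h _) _.
    by move=> D _; rewrite negb_forall_in => /exists_inP.
  rewrite lerD2l; apply: ler_sum => x _; rewrite [leRHS]big_mkcond [leLHS]big_mkcond.
  apply: ler_sum => D _ /=; rewrite inE /=.
  by case: (D \in sparing) => //=; case: (v \in D) => //=; case: ifP.
rewrite mulrAC ler_pdivrMr ?exprn_gt0 // [leRHS]mulrC; apply: le_trans step1.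
by rewrite -/T in tight; lra.
Qed.

Variable k : nat.
Hypothesis Z_small : (8 * #|Z| <= k * q)%N.
Hypothesis q_large : (2 ^ k <= 2 * q)%N.

(** A set containing the trace of a good line except for [v] blocks [v]. The weights [y] are at
    least [2 ^- k] on at least [q / 2] lines, so [q_large] gives them total at least 1/4. *)
Lemma sparing_blocked v : v \in Z -> 1 / 32 * N <= nf v.
Proof.
move=> vZ.
pose T l := Z :&: pts l :\ v.
pose y l : R := 2 ^- #|T l|.
have -> : 1 / 32 = (3 / 8) / 4 - 1 / 16 :> R by lra.
have y0 l : 0 <= y l by rewrite invr_ge0 exprn_ge0.
apply: (@second_moment_bound R _ L (fun=> 1)
  (fun D => (D \in sparing) && (v |: D \notin sparing)) (good v)
  (fun l D => (D \in sparing) && ((v \notin D) && (T l \subset D))) y) => //.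
- exact: ltW.
- lra.
- have yk l : l \in good v -> 2 ^- k <= y l.
    rewrite inE => /and4P[_ _ + _]; rewrite sumr_const => big.
    rewrite /y lef_pV2 ?posrE ?exprn_gt0 // ler_eXn2l ?ltr1n //.
    rewrite -(ler_nat R); apply: le_trans big _.
    by rewrite ler_pdivrMr // -!natrM ler_nat.
  apply: (@le_trans _ _ (\sum_(l in good v) 2 ^- k)); last exact: ler_sum.
  rewrite sumr_const -[leRHS]mulr_natl ler_pdivlMr ?exprn_gt0 //.
  have := card_sparing_good vZ; move: q_large.
  by rewrite -!(ler_nat R) !natrM natrX; lra.
- move=> l D lv /andP[DI /andP[vD TD]]; rewrite DI /=.
  move: lv; rewrite inE => /and4P[vl Fl _ _]; rewrite inE.
  apply/forallPn; exists l; rewrite Fl /= negbK; apply/subsetP => x xl.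
  rewrite !inE; case: eqP => //= /eqP xv; apply: (subsetP TD).
  by rewrite !inE xv; case/setIP: xl => -> ->.
- by move=> l lv; have := sparing_load_ge vZ lv.
- move=> l l' lv l'v ll'.
  have TT' : T l :&: T l' = set0.
    apply/setP => x; rewrite !inE; apply/negP.
    move: lv l'v; rewrite !inE => /and4P[vl _ _ _] /and4P[vl' _ _ _].
    case/andP=> /and3P[xv _ xl] /and3P[_ _ xl']; move/negP: ll'; case; apply/eqP.
    exact: (line_inj plane xl xl' vl vl' xv).
  have -> : y l * y l' = 2 ^- #|T l :|: T l'|.
    by rewrite /y -invfM -exprD cardsU TT' cards0 subn0.
  apply: le_trans (count_superset R sparing_down _).
  rewrite [leRHS]big_mkcond [leLHS]big_mkcond; apply: ler_sum => D _.
  rewrite subUset; case: (D \in sparing) => //=; case: (v \in D) => //=.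
  by case: ifP.
Qed.

End Sparing.

Lemma sum_cardI (R : realFieldType) (P : finType) (I : {set {set P}}) (Z : {set P}) :
  \sum_(D in I) #|D :&: Z|%:R = \sum_(v in Z) \sum_(D in I | v \in D) 1 :> R.
Proof.
rewrite (exchange_big_dep [in I]) /=; last by move=> v D _ /andP[].
apply: eq_bigr => D DI; rewrite -sumr_const; apply: eq_bigl => v.
by rewrite inE DI andbC.
Qed.

(* Conditioned on being sparing, a uniformly random set meets [Z] in noticeably
   fewer than half of its points; Markov's inequality then compares the sparing
   sets with the lower tail of the binomial distribution. *)
Lemma card_sparing_le (R : realFieldType) (P L : finType) (pts : L -> {set P})
    (q : nat) (F Z : {set P}) (k : nat) :
  affine_plane pts q -> (0 < q)%N -> [disjoint Z & F] -> (8 * #|F| <= q)%N ->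
  (q < 2 * #|Z|)%N -> (8 * #|Z| <= k * q)%N -> (2 ^ k <= 2 * q)%N ->
  (#|sparing pts F Z|%:R : R) <= 128 * #|Z|%:R / q%:R *
    #|[set D : {set P} | (#|D :&: Z|%:R : R) <= #|Z|%:R / 2 - q%:R / 256]|%:R.
Proof.
move=> plane q_gt0 ZF F_small Z_large Z_small q_large.
set I := sparing pts F Z; set z := #|Z|%:R : R.
have q0 : 0 < q%:R :> R by rewrite ltr0n.
have z0 : 0 < z by rewrite ltr0n; move: Z_large; case: #|Z|.
set low := [set D | _].
have NE : #|I|%:R = \sum_(D in I) 1 :> R by rewrite sumr_const.
have [N_le0|N0] := leP #|I|%:R (0 : R).
  by apply: le_trans N_le0 _; rewrite mulr_ge0 ?ler0n // divr_ge0 ?mulr_ge0 // ltW.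
set N := #|I|%:R in NE N0 *.
pose nf v : R := \sum_(D in I | v |: D \notin I) 1.
(* Otherwise every point of [Z] is blocked for at least [N / 32] sets, and more than [q / 2] points
   contradict the assumed bound. *)
have nf_large : q%:R / 64 * N <= \sum_(v in Z) nf v.
  rewrite leNgt; apply/negP => nf_small.
  have blocked v : v \in Z -> 1 / 32 * N <= nf v.
    move=> vZ; rewrite NE.
    apply: (sparing_blocked plane q_gt0 ZF F_small _ _ Z_small q_large vZ).
      by rewrite -NE.
    by rewrite -NE ltW.
  have : \sum_(v in Z) 1 / 32 * N <= \sum_(v in Z) nf v by exact: ler_sum.
  rewrite sumr_const -[leLHS]mulr_natl -/z => h.
  have := le_lt_trans h nf_small; rewrite mulrA ltr_pM2r // => h'.
  have : q%:R < 2 * z by rewrite /z -natrM ltr_nat.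
  by lra.
have meanI : \sum_(D in I) #|D :&: Z|%:R <= (z / 2 - q%:R / 128) * N.
  rewrite sum_cardI.
  have : \sum_(v in Z) (2 * \sum_(D in I | v \in D) 1) <= \sum_(v in Z) (N - nf v).
    apply: ler_sum => v _; rewrite NE; apply: count_mem_free.
    exact: sparing_down.
  by rewrite -mulr_sumr sumrB sumr_const -[_ *+ #|Z|]mulr_natl -/z; lra.
have split_low : N = \sum_(D in I | D \in low) 1 + \sum_(D in I | D \notin low) 1.
  by rewrite NE (bigID [in low]).
have lowI : \sum_(D in I | D \in low) 1 <= #|low|%:R :> R.
  rewrite -sumr_const [leRHS]big_mkcond [leLHS]big_mkcond; apply: ler_sum => D _.
  by case: (D \in I); case: (D \in low).
have highI : (z / 2 - q%:R / 256) * \sum_(D in I | D \notin low) 1 <=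
    \sum_(D in I) #|D :&: Z|%:R.
  rewrite mulr_sumr [leRHS]big_mkcond [leLHS]big_mkcond; apply: ler_sum => D _.
  rewrite mulr1; case: (D \in I) => //=; case: ifP => [|_]; last exact: ler0n.
  by rewrite inE -ltNge => /ltW.
set a := \sum_(D in I | D \in low) 1 in split_low lowI.
set b := \sum_(D in I | D \notin low) 1 in split_low highI.
have a0 : 0 <= a by exact: sumr_ge0.
rewrite mulrAC ler_pdivlMr //.
have h : q%:R / 256 * N <= z / 2 * a.
  have : (z / 2 - q%:R / 256) * b <= (z / 2 - q%:R / 128) * N by apply: le_trans meanI.
  rewrite split_low; have : 0 <= q%:R * a by rewrite mulr_ge0 // ltW.
  by lra.
have : z * a <= z * #|low|%:R by rewrite ler_pM2l.
by lra.
Qed.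

(** * Lower tail of the binomial distribution *)

Section Chernoff.
Variable R : realType.

(** By 1 + x <= exp(x) at both signs, the left side is at most 2 / (1 - u^2). *)
Lemma cosh_le (u : R) : 0 <= u <= 1 / 2 ->
  expR u + expR (- u) <= 2 * expR (2 * u ^+ 2).
Proof.
move=> /andP[u0 u1].
have h1 : expR u <= (1 - u)^-1.
  rewrite -[leLHS]invrK lef_pV2 ?posrE ?invr_gt0 ?expR_gt0 //; last by lra.
  by rewrite -expRN; have := expR_ge1Dx (- u); lra.
have h2 : expR (- u) <= (1 + u)^-1.
  rewrite expRN lef_pV2 ?posrE ?expR_gt0 //; last by lra.
  exact: expR_ge1Dx.
have h3 : (1 - u)^-1 + (1 + u)^-1 <= 2 * (1 + 2 * u ^+ 2).
  have x0 : 0 <= u ^+ 2 by exact: sqr_ge0.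
  have x1 : u ^+ 2 <= 1 / 4 by rewrite expr2; nra.
  have -> : (1 - u)^-1 + (1 + u)^-1 = 2 / (1 - u ^+ 2).
    by field; apply/and3P; split; apply/eqP; nra.
  rewrite ler_pdivrMr; last by lra.
  by set x := u ^+ 2 in x0 x1 *; nra.
have := expR_ge1Dx (2 * u ^+ 2); lra.
Qed.

(** Exponential moments at [s = h / z]: the exponent z s^2 / 2 - s h equals - h^2 / (2 z). *)
Lemma binomial_lower_tail (P : finType) (Z : {set P}) (h : R) :
  0 <= h <= #|Z|%:R ->
  #|[set D : {set P} | (#|D :&: Z|%:R : R) <= #|Z|%:R / 2 - h]|%:R <=
    2 ^+ #|P| * expR (- (h ^+ 2 / (2 * #|Z|%:R))).
Proof.
move=> /andP[h0 hz]; set z : R := #|Z|%:R in hz *.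
have [z_le0|z0] := leP z 0.
  have -> : h = 0 by lra.
  rewrite expr0n mul0r oppr0 expR0 mulr1 -natrX ler_nat -cardsT -card_powerset powersetT.
  exact/subset_leq_card/subsetT.
pose s := h / z.
have s1 : 0 <= s / 2 <= 1 / 2.
  by apply/andP; split; rewrite /s;
    [rewrite !divr_ge0 // ltW|rewrite ler_pdivrMr // ler_pdivrMr //; lra].
set low := [set D | _].
have step1 : #|low|%:R <= \sum_(D : {set P}) expR (s * (z / 2 - h)) * expR (- s) ^+ #|D :&: Z|.
  rewrite -sumr_const big_mkcond; apply: ler_sum => D _.
  rewrite -expRM_natl -expRD; case: ifP => [|_]; last exact: expR_ge0.
  rewrite inE => Dlow; rewrite -[leLHS]expR0 ler_expR.
  have -> : s * (z / 2 - h) + #|D :&: Z|%:R * - s = s * (z / 2 - h - #|D :&: Z|%:R) by ring.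
  by rewrite mulr_ge0 //; lra.
apply: (le_trans step1); rewrite -mulr_sumr sum_expr_cardI.
have cP : #|P| = (#|Z| + #|~: Z|)%N by rewrite cardsC.
rewrite cP exprD mulrA -[leRHS]mulrA [X in _ <= _ * X]mulrC [leRHS]mulrA.
rewrite ler_wpM2r ?exprn_ge0 //.
have -> : expR (s * (z / 2 - h)) = expR (s / 2) ^+ #|Z| * expR (- (s * h)).
  by rewrite -expRM_natl -expRD -/z; congr expR; field.
rewrite mulrAC -exprMn.
have -> : expR (s / 2) * (expR (- s) + 1) = expR (s / 2) + expR (- (s / 2)).
  rewrite mulrDr mulr1 -expRD addrC; congr (_ + expR _); lra.
apply: (@le_trans _ _ ((2 * expR (2 * (s / 2) ^+ 2)) ^+ #|Z| * expR (- (s * h)))).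
  rewrite ler_wpM2r ?expR_ge0 // lerXn2r ?nnegrE ?cosh_le //.
    by rewrite addr_ge0 // expR_ge0.
  by rewrite mulr_ge0 // expR_ge0.
rewrite exprMn -mulrA -expRM_natl -expRD -/z.
rewrite le_eqVlt; apply/orP; left; apply/eqP; congr (_ * expR _).
by rewrite /s; field; rewrite gt_eqF.
Qed.

End Chernoff.

(** * The random point set *)

Section PointSet.
Variables (R : realType) (P L : finType) (pts : L -> {set P}) (q : nat).
Hypothesis plane : affine_plane pts q.
Hypothesis q_gt0 : (0 < q)%N.

(** The bad choices of [S] for a pair: a transversal inside [S] covered by the pair puts [S]
    here. *)
Definition blocking (F Z : {set P}) : {set {set P}} :=
  [set S : {set P} | [forall l, (F :|: (Z :&: S)) :&: pts l != set0]].

Lemma card_hitting (X : {set P}) :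
  (forall l, X :&: pts l != set0) -> (q <= #|X|)%N.
Proof.
have [_ _ deg _] := plane; move=> hit.
rewrite -(leq_pmul2r (ltn0Sn q)) -(card_lines plane q_gt0).
have -> : #|L| = (\sum_(l : L) 1)%N by rewrite sum1_card.
apply: (@leq_trans (\sum_l \sum_(x in X | x \in pts l) 1)%N).
  apply: leq_sum => l _; have /set0Pn[x] := hit l; rewrite inE => /andP[xX xl].
  by rewrite (bigD1 x) ?xX.
rewrite (exchange_big_dep [in X]) /=; last by move=> l x _ /andP[].
rewrite -sum_nat_const; apply: leq_sum => x xX.
rewrite -(deg x) -sum1_card; apply: eq_leq; apply: eq_bigl => l.
by rewrite inE xX.
Qed.

(** If [Z] has at most [q / 2] points, too few points are left to hit all lines. Otherwise
    complementation lands in the sparing sets, and the tail bound is used with [h = q / 256]. *)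
Lemma card_blocking_le (F Z : {set P}) (K : nat) : [disjoint Z & F] ->
  (8 * #|F| <= q)%N -> (0 < K)%N -> (#|Z| <= K * q)%N -> (2 ^ (8 * K) <= q)%N ->
  #|blocking F Z|%:R <=
    128 * K%:R * (2 ^+ #|P| * expR (- (q%:R / (2 ^+ 17 * K%:R)))) :> R.
Proof.
move=> ZF F_small K_gt0 Z_small q_large.
have q0 : 0 < q%:R :> R by rewrite ltr0n.
have K0 : 0 < K%:R :> R by rewrite ltr0n.
have [Z_tiny|Z_large] := leqP (2 * #|Z|) q.
  suff -> : blocking F Z = set0.
    by rewrite cards0 mulr_ge0 ?mulr_ge0 ?expR_ge0 ?exprn_ge0 ?ltW.
  apply/eqP; rewrite -subset0; apply/subsetP => S; rewrite inE => /forallP hit.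
  have := card_hitting hit.
  have := leq_trans (subset_leq_card (subsetIl Z S)) (leqnn _).
  have := (leq_card_setU F (Z :&: S)).1; lia.
have sub : (#|blocking F Z| <= #|sparing pts F Z|)%N.
  rewrite -(card_imset _ (@setC_inj P)); apply: subset_leq_card.
  apply/subsetP => _ /imsetP[S + ->]; rewrite !inE => /forallP hit.
  apply/forallP => l; apply/implyP => /eqP Fl; apply/negP => Zl.
  have /set0Pn[x] := hit l; rewrite setIUl Fl set0U => /setIP[/setIP[xZ xS] xl].
  have : x \in ~: S by apply: (subsetP Zl); rewrite inE xZ.
  by rewrite inE xS.
have z0 : 0 < #|Z|%:R :> R by rewrite ltr0n; lia.
have zK : #|Z|%:R <= K%:R * q%:R :> R by rewrite -natrM ler_nat.
have qz : q%:R <= 2 * #|Z|%:R :> R by rewrite -natrM ler_nat ltnW.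
have card_sp := @card_sparing_le R P L pts q F Z (8 * K) plane q_gt0 ZF F_small
  Z_large (_ : _ <= _)%N (_ : _ <= _)%N.
apply: (@le_trans _ _ #|sparing pts F Z|%:R); first by rewrite ler_nat.
apply: (le_trans (card_sp _ _)).
- by rewrite -mulnA leq_mul2l Z_small orbT.
- by apply: (leq_trans q_large); rewrite leq_pmull.
apply: ler_pM; rewrite ?ler0n //.
- by rewrite divr_ge0 ?mulr_ge0 ?ler0n.
- by rewrite ler_pdivrMr // -mulrA ler_pM2l.
apply: le_trans (binomial_lower_tail _) _.
  by apply/andP; split; lra.
rewrite ler_pM2l ?exprn_gt0 // ler_expR lerN2.
have -> : q%:R / (2 ^+ 17 * K%:R) = q%:R ^+ 2 / (2 ^+ 17 * (K%:R * q%:R)) :> R.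
  by field; rewrite !gt_eqF.
have -> : (q%:R / 256) ^+ 2 / (2 * #|Z|%:R) = q%:R ^+ 2 / (2 ^+ 17 * #|Z|%:R) :> R.
  by field; rewrite gt_eqF.
rewrite ler_pM2l ?exprn_gt0 // lef_pV2 ?posrE ?mulr_gt0 ?exprn_gt0 //.
by rewrite ler_pM2l ?exprn_gt0.
Qed.

Lemma card_light_le (Z : {set P}) :
  #|[set S : {set P} | (#|S :&: Z|%:R : R) <= 9 / 20 * #|Z|%:R]|%:R <=
    2 ^+ #|P| * expR (- (#|Z|%:R / 800)) :> R.
Proof.
have [/eqP|Z0] := posnP #|Z|.
  rewrite cards_eq0 => /eqP ->; rewrite cards0 mul0r oppr0 expR0 mulr1.
  by rewrite -natrX ler_nat -cardsT -card_powerset powersetT subset_leq_card ?subsetT.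
have z0 : 0 < #|Z|%:R :> R by rewrite ltr0n.
have hZ : 0 <= (#|Z|%:R / 20 : R) <= #|Z|%:R by apply/andP; split; lra.
apply: le_trans (le_trans (binomial_lower_tail hZ) _).
  rewrite ler_nat; apply: subset_leq_card; apply/subsetP => S; rewrite !inE; lra.
rewrite ler_pM2l ?exprn_gt0 // ler_expR lerN2.
by rewrite le_eqVlt; apply/orP; left; apply/eqP; field; rewrite gt_eqF.
Qed.

Lemma exists_point_set (K : nat) (cs : seq ({set P} * {set P})) :
  (0 < K)%N -> (2 ^ (8 * K) <= q)%N ->
  {in cs, forall c : {set P} * {set P}, [/\ (8 * #|c.1| <= q)%N,
    (#|c.2| <= K * q)%N & [disjoint c.2 & c.1]]} ->
  (size cs)%:R * (128 * K%:R * expR (- (q%:R / (2 ^+ 17 * K%:R)))) +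
    (q * q.+1).+1%:R * expR (- (q%:R / 800)) < 1 :> R ->
  exists S : {set P}, [/\ forall l, 9 / 20 * q%:R < #|S :&: pts l|%:R :> R,
    #|S|%:R <= 11 / 20 * q%:R ^+ 2 :> R
    & {in cs, forall c : {set P} * {set P},
        exists l, (c.1 :|: (c.2 :&: S)) :&: pts l = set0}].
Proof.
have [cP cl _ _] := plane.
move=> K_gt0 q_large cs_bound small.
pose light l := [set S : {set P} | (#|S :&: pts l|%:R : R) <= 9 / 20 * #|pts l|%:R].
(* Applied to the complement of [S], this lower tail bounds the size of [S] from above. *)
pose sparse := [set S : {set P} | (#|S :&: setT|%:R : R) <= 9 / 20 * #|[set: P]|%:R].
have [S /and3P[S_lines S_size S_cs]] : exists S : {set P},
    [&& [forall l, S \notin light l], ~: S \notin sparse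
      & all (fun c => S \notin blocking c.1 c.2) cs].
  apply/existsP/contraT; rewrite negb_exists => /forallP all_bad.
  set e : R := (size cs)%:R * _ + _ in small.
  suff : 2 ^+ #|P| <= 2 ^+ #|P| * e.
    by rewrite -[leLHS]mulr1 ler_pM2l ?exprn_gt0 // leNgt small.
  have bad S : 1 <= \sum_l (S \in light l)%:R + (~: S \in sparse)%:R +
      \sum_(c <- cs) (S \in blocking c.1 c.2)%:R :> R.
    have s1 : 0 <= \sum_l (S \in light l)%:R :> R by exact: sumr_ge0.
    have s2 : 0 <= \sum_(c <- cs) (S \in blocking c.1 c.2)%:R :> R by exact: sumr_ge0.
    have := all_bad S; rewrite !negb_and => /or3P[|/negPn ->|].
    + move/forallPn => [l /negPn Sl].
      have : 1 <= \sum_l (S \in light l)%:R :> R.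
        by rewrite (bigD1 l) //= Sl lerDl sumr_ge0.
      have : 0 <= (~: S \in sparse)%:R :> R by exact: ler0n.
      lra.
    + by rewrite mulr1n; lra.
    + rewrite -has_predC => /hasP[c c_cs /negPn /= Sc].
      have : 1 <= \sum_(c <- cs) (S \in blocking c.1 c.2)%:R :> R.
        by rewrite (big_rem c) //= Sc lerDl sumr_ge0.
      have : 0 <= (~: S \in sparse)%:R :> R by exact: ler0n.
      lra.
  have count (A : {set {set P}}) : \sum_S (S \in A)%:R = #|A|%:R :> R.
    by rewrite -sumr_const [RHS]big_mkcond; apply: eq_bigr => S _; case: (S \in A).
  have total : 2 ^+ #|P| = \sum_(S : {set P}) 1 :> R.
    rewrite -natrX -cardsT -card_powerset powersetT -count.
    by apply: eq_bigr => S _; rewrite inE.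
  rewrite [leLHS]total; apply: (le_trans (ler_sum _ (fun S _ => bad S))).
  rewrite !big_split /= exchange_big /= [X in _ + X <= _]exchange_big /=.
  have lightE : \sum_l \sum_S (S \in light l)%:R <=
      (q * q.+1)%:R * (2 ^+ #|P| * expR (- (q%:R / 800))) :> R.
    rewrite -(card_lines plane q_gt0) mulr_natl -sumr_const; apply: ler_sum => l _.
    by rewrite count -[in leRHS](cl l); exact: card_light_le.
  have sparseE : \sum_S (~: S \in sparse)%:R <= 2 ^+ #|P| * expR (- (q%:R / 800)) :> R.
    rewrite (reindex_inj (@setC_inj P)) /=; under eq_bigr => S _ do rewrite setCK.
    rewrite count; apply: le_trans (card_light_le _) _.
    rewrite ler_pM2l ?exprn_gt0 // ler_expR lerN2 ler_pM2r ?invr_gt0 //.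
    by rewrite ler_nat cardsT cP leq_pmulr.
  have csE : \sum_(c <- cs) \sum_S (S \in blocking c.1 c.2)%:R <= (size cs)%:R *
      (128 * K%:R * (2 ^+ #|P| * expR (- (q%:R / (2 ^+ 17 * K%:R))))) :> R.
    rewrite mulr_natl -[X in _ *+ X]sum1_size -sumrMnr big_seq [leRHS]big_seq.
    apply: ler_sum => c /cs_bound[c1 c2 c3]; rewrite count mulr1n.
    exact: card_blocking_le.
  apply: (le_trans (lerD (lerD lightE sparseE) csE)).
  rewrite le_eqVlt; apply/orP; left; apply/eqP; rewrite /e -[(q * q.+1).+1%:R]natr1.
  ring.
exists S; split.
- by move=> l; have := forallP S_lines l; rewrite inE -ltNge cl.
- move: S_size; rewrite inE -ltNge setIT cardsT cP natrM => h.
  have : #|S|%:R + #|~: S|%:R = q%:R * q%:R :> R by rewrite -natrD cardsC cP natrM.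
  by rewrite expr2; lra.
- move=> c /(allP S_cs); rewrite inE => /forallPn[l /negPn/eqP cl0].
  by exists l.
Qed.

End PointSet.

(** * The affine plane over a prime field *)

Section FieldPlane.
Variable p : nat.
Hypothesis p_pr : prime p.

(* Non-vertical lines [(slope, intercept)], then vertical lines. *)
Definition field_line (l : ('F_p * 'F_p) + 'F_p) : {set 'F_p * 'F_p} :=
  match l with
  | inl mc => [set z | z.2 == mc.1 * z.1 + mc.2]
  | inr c => [set z | z.1 == c]
  end.

Lemma field_plane : affine_plane field_line p.
Proof.
split.
- by rewrite card_prod card_Fp.
- case=> [[m c]|c] /=.
    rewrite -[RHS](card_Fp p_pr) -cardsT.
    rewrite -(@card_imset _ _ (fun x => (x, m * x + c)) setT); last by move=> x y [].
    apply: eq_card => -[x y]; rewrite !inE /=; apply/eqP/imsetP => [->|[x' _ [-> ->]] //].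
    by exists x; rewrite ?inE.
  rewrite -[RHS](card_Fp p_pr) -cardsT.
  rewrite -(@card_imset _ _ (fun y => (c, y)) setT); last by move=> x y [].
  apply: eq_card => -[x y]; rewrite !inE /=; apply/eqP/imsetP => [->|[y' _ [-> _]] //].
  by exists y; rewrite ?inE.
- move=> [x y].
  have -> : p.+1 = #|{: option 'F_p}| by rewrite card_option card_Fp.
  pose h (o : option 'F_p) : ('F_p * 'F_p) + 'F_p :=
    if o is Some m then inl (m, y - m * x) else inr x.
  rewrite -cardsT -(@card_imset _ _ h setT); last first.
    by move=> [m|] [m'|] //= [->].
  apply: eq_card => -[[m c]|c]; rewrite !inE /=; apply/eqP/imsetP.
  + by move=> yE; exists (Some m); rewrite ?inE //= yE addrC addKr.
  + by case=> -[m'|] // _ [-> ->]; rewrite addrC subrK.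
  + by move=> xE; exists None; rewrite ?inE //= xE.
  + by case=> -[m'|] // _ [->].
- move=> [x y] [x' y'] xy; apply/eqP/cards1P.
  have [xx'|xx'] := eqVneq x x'.
    exists (inr x); apply/setP => -[[m c]|c]; rewrite !inE /=.
      apply/negP => /andP[/eqP yE /eqP y'E]; move/eqP: xy; apply.
      by rewrite xx' yE y'E xx'.
    by rewrite -xx' andbb eq_sym; apply/eqP/eqP => [->|[->]].
  have dx : x - x' != 0 by rewrite subr_eq0.
  pose m := (y - y') / (x - x').
  have mE : m * (x - x') = y - y' by rewrite /m divfK.
  exists (inl (m, y - m * x)); apply/setP => -[[m' c]|c]; rewrite !inE /=.
    apply/andP/eqP => [[/eqP yE /eqP y'E]|[-> ->]].
      have m'm : m' = m by rewrite /m yE y'E; field.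
      by rewrite -m'm; congr (inl (_, _)); rewrite yE; ring.
    split; apply/eqP; first by ring.
    by have -> : y' = y - m * (x - x') by [rewrite mE; ring]; ring.
  by apply/negP => /andP[/eqP <- /eqP]; apply/eqP; rewrite eq_sym.
Qed.

End FieldPlane.

(** * Choice of the parameters *)

(* Here [L] is about [log q] and [l] is about [log log q] (in base 2). *)
Lemma exists_parameters (N : nat) : exists q l L, [/\ prime q, (N <= q)%N,
  (64 <= l)%N, (2 ^ l <= L < 2 ^ l.+1)%N & (2 ^ L <= q < 2 ^ L.+1)%N].
Proof.
(* The bound on [q] forces [l >= 64]; the variable keeps the double exponential from being
   evaluated. *)
have [n64 n64E] : exists n, n = 64%N by exists 64%N.
have [q q_large q_pr] := prime_above (maxn N (2 ^ (2 ^ n64))).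
have [Nq nq] : (N <= q /\ 2 ^ (2 ^ n64) <= q)%N.
  by move: q_large; rewrite gtn_max => /andP[/ltnW ? /ltnW].
have order_gt0 : (0 < q)%N by exact: prime_gt0.
pose L := trunc_log 2 q; pose l := trunc_log 2 L.
have nL : (2 ^ n64 <= L)%N by rewrite trunc_log_max.
have L_gt0 : (0 < L)%N by apply: leq_trans nL; rewrite expn_gt0.
exists q, l, L; split=> //; [|exact: trunc_log_bounds..].
by rewrite -[X in (X <= _)%N]n64E trunc_log_max.
Qed.

Lemma expR_inv_le (R : realType) (x : R) : 0 < x -> expR (- x) <= x^-1.
Proof.
move=> x0; rewrite expRN lef_pV2 ?posrE ?expR_gt0 //.
by have := expR_ge1Dx x; lra.
Qed.

Lemma ln2_bounds (R : realType) : 1 / 2 <= ln (2 : R) <= 1.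
Proof.
apply/andP; split.
  rewrite -ler_expR lnK ?posrE //.
  rewrite -[leLHS]invrK -[leRHS]invrK lef_pV2 ?posrE ?invr_gt0 ?expR_gt0 //.
  by rewrite -expRN; have := expR_ge1Dx (- (1 / 2) : R); lra.
rewrite -[leRHS]expRK ler_ln ?posrE ?expR_gt0 //.
by have := expR_ge1Dx (1 : R); lra.
Qed.

Section ParameterChoice.
Variables l L : nat.
Hypothesis l64 : (64 <= l)%N.
Hypothesis L_bounds : (2 ^ l <= L < 2 ^ l.+1)%N.

(** The 16 is large enough for (L^8)^t <= 2^L and small enough for the constant 100 of the
    theorem. *)
Definition load_bound : nat := L %/ (16 * l).
(** The power 6 keeps the cost of a phase below [q / L ^ 4], so that all phases together give only
    exp(3 q / L^2) pairs. *)
Definition fugacity_inv : nat := L ^ 6.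

Let t := load_bound.
Let B := fugacity_inv.

Lemma expn_geq_mul (n : nat) : (n <= 30)%N -> (2 ^ n * l <= L)%N.
Proof.
move=> n30; have /andP[lL _] := L_bounds; apply: leq_trans lL.
have -> : (2 ^ l = 2 ^ n * 2 ^ (l - n))%N by rewrite -expnD subnKC //; lia.
rewrite leq_mul2l; apply/orP; right.
have -> : (2 ^ (l - n) = 32 * 2 ^ (l - n - 5))%N.
  by rewrite -[32%N]/(2 ^ 5)%N -expnD; congr expn; lia.
have := ltn_expl (l - n - 5) (isT : 1 < 2)%N; lia.
Qed.

Lemma L_ge_mul : (1024 * l <= L)%N.
Proof. exact: (@expn_geq_mul 10). Qed.

Lemma load_bound_mul : (t * (16 * l) <= L)%N.
Proof. exact: leq_trunc_div. Qed.

Lemma ltn_load_boundS : (L < t.+1 * (16 * l))%N.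
Proof. by rewrite ltn_ceil // muln_gt0 /=; move: l64; case: l. Qed.

Lemma load_bound_ge3 : (3 <= t)%N.
Proof. by have := ltn_load_boundS; have := L_ge_mul; move: l64; nia. Qed.

Lemma load_bound_mul64 : (64 * t <= L)%N.
Proof. by have := load_bound_mul; move: l64; nia. Qed.

Lemma load_bound_mul512 : (512 * t <= L)%N.
Proof. by have := load_bound_mul; move: l64; nia. Qed.

Lemma L_gt0 : (0 < L)%N.
Proof. by have := L_ge_mul; move: l64; lia. Qed.

Lemma L_ge2 : (2 <= L)%N.
Proof. by have := L_ge_mul; move: l64; lia. Qed.

Lemma fugacity_inv_ge36 : (36 <= B)%N.
Proof.
have L36 : (36 <= L)%N by have := L_ge_mul; move: l64; lia.
apply: leq_trans L36 _; rewrite -[X in (X <= _)%N]expn1 /B /fugacity_inv.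
by rewrite leq_pexp2l // L_gt0.
Qed.

Variable q : nat.
Hypothesis q_bounds : (2 ^ L <= q < 2 ^ L.+1)%N.

Definition phase_cost : nat := ((8 * t * q) %/ B).+1.
(** Enough halvings to leave containers of at most [64 * t * q] points. *)
Definition phase_count : nat := trunc_log 2 (q %/ t) - 5.

Let k := phase_cost.
Let I := phase_count.

Lemma order_gt0 : (0 < q)%N.
Proof. by have /andP[h _] := q_bounds; apply: leq_trans h; rewrite expn_gt0. Qed.

(** Since L < 2^(l + 1) and 2^L <= q, comparing powers of [L] with [q] becomes linear in the
    exponents. *)
Lemma expL_le (a b : nat) : (a + b * l.+1 <= L)%N -> (2 ^ a * L ^ b <= q)%N.
Proof.
move=> ab; have /andP[+ _] := q_bounds; apply: leq_trans.
apply: (@leq_trans (2 ^ (a + b * l.+1))); last by rewrite leq_exp2l.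
rewrite expnD leq_mul2l; apply/orP; right; rewrite mulnC expnM.
by have /andP[_ /ltnW h] := L_bounds; case: b {ab} => // b; rewrite leq_exp2r.
Qed.

Lemma fugacity_load_le : ((128 * B * t) ^ t <= q)%N.
Proof.
have t0 : (0 < t)%N by exact: leq_trans load_bound_ge3.
apply: (@leq_trans ((L ^ 8) ^ t)).
  rewrite leq_exp2r // -[8%N]/(6 + 2)%N expnD -mulnA mulnCA leq_mul2l.
  apply/orP; right; have := load_bound_mul64; have := L_ge_mul; move: l64.
  by rewrite expnS expn1 => *; apply: leq_mul; lia.
rewrite -expnM -[X in (X <= _)%N]mul1n -[1%N]/(2 ^ 0)%N; apply: expL_le.
by have := load_bound_mul; move: l64; nia.
Qed.

Lemma phase_cost_large : (8 * t * q < k * B)%N.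
Proof. by rewrite ltn_ceil // expn_gt0 L_gt0. Qed.

Lemma phase_cost_le : (k * L ^ 4 <= q)%N.
Proof.
have h1 : (2 ^ 1 * L ^ 4 <= q)%N.
  by apply: expL_le; have := L_ge_mul; move: l64; lia.
have h2 : ((8 * t * q) %/ B * B <= 8 * t * q)%N by exact: leq_trunc_div.
have h3 : ((8 * t * q) %/ B * L ^ 5 <= q)%N.
  rewrite -(leq_pmul2l L_gt0) mulnCA -expnS; apply: leq_trans h2 _.
  by rewrite leq_mul2r; apply/orP; right; have := load_bound_mul64; lia.
have h4 : (2 * ((8 * t * q) %/ B * L ^ 4) <= q)%N.
  apply: leq_trans h3; rewrite mulnCA [X in (_ <= _ * X)%N]expnS leq_mul2l.
  by apply/orP; right; rewrite leq_mul2r; apply/orP; right; have := L_ge_mul; move: l64; lia.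
by rewrite /k /phase_cost -/t -/B mulSn; lia.
Qed.

Lemma ratio_ge64 : (2 ^ 6 <= q %/ t)%N.
Proof.
have t0 : (0 < t)%N by exact: leq_trans load_bound_ge3.
rewrite leq_divRL //; apply: (@leq_trans (2 ^ 6 * L ^ 1)); last first.
  by apply: expL_le; have := L_ge_mul; move: l64; lia.
by rewrite expn1 leq_mul2l; have := load_bound_mul64; lia.
Qed.

Lemma log_ratio_ge5 : (5 <= trunc_log 2 (q %/ t))%N.
Proof.
by apply: (@leq_trans 6) => //; rewrite trunc_log_max // ratio_ge64.
Qed.

Lemma phase_count_scale : (2 ^ (I + 4) * (2 * t) <= q)%N.
Proof.
have t0 : (0 < t)%N by exact: leq_trans load_bound_ge3.
rewrite mulnA -expnSr -addnS subnK ?log_ratio_ge5 // -leq_divRL // trunc_logP //.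
by apply: leq_trans ratio_ge64.
Qed.

Lemma phase_count_fine : (q <= 2 ^ I * (64 * t))%N.
Proof.
have t0 : (0 < t)%N by exact: leq_trans load_bound_ge3.
have := trunc_log_ltn (q %/ t) (isT : 1 < 2)%N.
rewrite -(subnK log_ratio_ge5) -/I -addnS ltn_divLR // => /ltnW.
by rewrite expnD -mulnA.
Qed.

Lemma phase_count_le : (I <= L)%N.
Proof.
have : (2 ^ I < 2 ^ L.+1)%N.
  have /andP[_ h] := q_bounds; apply: leq_ltn_trans h.
  apply: leq_trans phase_count_scale; rewrite expnD -mulnA leq_pmulr // !muln_gt0 /=.
  exact: leq_trans load_bound_ge3.
by rewrite ltn_exp2l.
Qed.

Lemma total_cost_le : (8 * (I * k) <= q)%N.
Proof.
apply: leq_trans phase_cost_le; rewrite mulnA mulnC leq_mul2l; apply/orP; right.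
apply: (@leq_trans (8 * L)); first by rewrite leq_mul2l phase_count_le orbT.
rewrite expnSr leq_mul2r; apply/orP; right.
apply: (@leq_trans L); first by have := L_ge_mul; move: l64; lia.
by rewrite -[X in (X <= _)%N]expn1 leq_pexp2l // L_gt0.
Qed.

Lemma expn_load_bound_le : (2 ^ (8 * (64 * t)) <= q)%N.
Proof.
have /andP[+ _] := q_bounds; apply: leq_trans; rewrite leq_exp2l //.
by have := load_bound_mul512; lia.
Qed.

Variable R : realType.

Lemma family_size_le (s : nat) : (s <= ((q * q).+1 ^ k) ^ I)%N ->
  s%:R <= expR (3 * q%:R / L%:R ^+ 2) :> R.
Proof.
move=> sE; have L0 : 0 < L%:R :> R by rewrite ltr0n L_gt0.
pose e := ((2 * L + 2) * (k * I))%N.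
have se : (s <= 2 ^ e)%N.
  apply: (leq_trans sE); rewrite -expnM /e [X in (_ <= X)%N]expnM.
  case: (k * I)%N => // n; rewrite leq_exp2r //.
  have /andP[_ h] := q_bounds; apply: (@leq_trans (2 ^ L.+1 * 2 ^ L.+1)).
    by apply: ltn_mul.
  by rewrite -expnD leq_exp2l //; lia.
have eq : (e * L ^ 2 <= 3 * q)%N.
  apply: (@leq_trans (3 * L * (k * L) * L ^ 2)).
    rewrite leq_mul2r; apply/orP; right; rewrite /e leq_mul //.
      by have := L_ge_mul; move: l64; lia.
    by rewrite leq_mul2l phase_count_le orbT.
  have -> : (3 * L * (k * L) * L ^ 2 = 3 * (k * L ^ 4))%N by rewrite !expnS expn0; lia.
  by rewrite leq_mul2l phase_cost_le.
apply: (@le_trans _ _ ((2 ^ e)%N%:R)); first by rewrite ler_nat.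
rewrite natrX; apply: (@le_trans _ _ (expR 1 ^+ e)).
  by apply: lerXn2r; rewrite ?nnegrE ?expR_ge0 //; have := expR_ge1Dx (1 : R); lra.
rewrite -expRM_natl mulr1 ler_expR ler_pdivlMr ?exprn_gt0 //.
by rewrite -natrX -!natrM ler_nat.
Qed.

(** Half of the exponent q / (2^17 L) pays for the number of pairs, and the other half for the
    factor 128 L. The light lines are handled by exp(-y) <= 6 / y^3. *)
Lemma failure_probability_lt1 (s : nat) : (s <= ((q * q).+1 ^ k) ^ I)%N ->
  s%:R * (128 * (64 * t)%:R * expR (- (q%:R / (2 ^+ 17 * (64 * t)%:R)))) +
    (q * q.+1).+1%:R * expR (- (q%:R / 800)) < 1 :> R.
Proof.
move=> sE; have s_le := family_size_le sE.
have L0 : 0 < L%:R :> R by rewrite ltr0n L_gt0.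
have q0 : 0 < q%:R :> R by rewrite ltr0n order_gt0.
have L_large : 2 ^+ 23 <= L%:R :> R.
  rewrite -natrX ler_nat; apply: leq_trans (@expn_geq_mul 23 isT).
  by rewrite leq_pmulr //; exact: leq_trans l64.
have q_large : 2 ^+ 27 * L%:R ^+ 2 <= q%:R :> R.
  rewrite -!natrX -natrM ler_nat; apply: expL_le.
  by have := L_ge_mul; move: l64; lia.
set K : R := (64 * t)%:R.
have K0 : 0 < K by rewrite ltr0n muln_gt0 /=; exact: leq_trans load_bound_ge3.
have KL : K <= L%:R by rewrite ler_nat load_bound_mul64.
set x : R := q%:R / (2 ^+ 18 * L%:R).
have x0 : 0 < x by rewrite divr_gt0 ?mulr_gt0 ?exprn_gt0.
have h1 : s%:R * (128 * K * expR (- (q%:R / (2 ^+ 17 * K)))) <= 128 * L%:R * expR (- x).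
  apply: (@le_trans _ _ (128 * L%:R *
      (expR (3 * q%:R / L%:R ^+ 2) * expR (- (q%:R / (2 ^+ 17 * L%:R)))))).
    rewrite mulrCA; apply: ler_pM; rewrite ?mulr_ge0 ?expR_ge0 ?ler0n ?(ltW K0) //.
      by rewrite ler_pM2l.
    apply: ler_pM; rewrite ?expR_ge0 ?ler0n // ler_expR lerN2 ler_pM2l //.
    by rewrite lef_pV2 ?posrE ?mulr_gt0 ?exprn_gt0 // ler_pM2l ?exprn_gt0.
  rewrite ler_pM2l ?mulr_gt0 // -expRD ler_expR.
  have -> : q%:R / (2 ^+ 17 * L%:R) = x + x by rewrite /x; field; rewrite gt_eqF.
  suff : 3 * q%:R / L%:R ^+ 2 <= x by lra.
  have -> : 3 * q%:R / L%:R ^+ 2 = 3 / L%:R * (q%:R / L%:R) :> R by field; rewrite gt_eqF.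
  have -> : x = (2 ^+ 18)^-1 * (q%:R / L%:R) by rewrite /x; field; rewrite gt_eqF.
  rewrite ler_pM2r ?divr_gt0 // ler_pdivrMr // mulrC ler_pdivlMr ?exprn_gt0 //.
  by apply: le_trans L_large; lra.
have h2 : 128 * L%:R * expR (- x) <= 1 / 4.
  apply: (@le_trans _ _ (128 * L%:R * x^-1)).
    by rewrite ler_pM2l ?mulr_gt0 // expR_inv_le.
  rewrite /x invf_div mulrA ler_pdivrMr //.
  have -> : 128 * L%:R * (2 ^+ 18 * L%:R) = 2 ^+ 25 * L%:R ^+ 2 :> R by ring.
  by move: q_large; rewrite -[27%N]/(2 + 25)%N exprD; lra.
set y : R := q%:R / 800.
have y0 : 0 < y by rewrite divr_gt0.
have q_huge : 2 ^+ 50 <= q%:R :> R.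
  apply: le_trans q_large; rewrite -[50%N]/(27 + 23)%N exprD ler_pM2l ?exprn_gt0 //.
  by apply: (le_trans L_large); rewrite expr2 ler_peMl ?(ltW L0) //; apply: le_trans L_large; lra.
have h3 : (q * q.+1).+1%:R <= 3 * q%:R ^+ 2 :> R.
  have q1 : 1 <= q%:R :> R by rewrite ler1n order_gt0.
  by rewrite -natr1 natrM -natr1 expr2; nra.
have h4 : expR (- y) <= 6 * 800 ^+ 3 / q%:R ^+ 3.
  rewrite expRN; apply: (@le_trans _ _ ((y ^+ 3 / 6)^-1)).
    rewrite lef_pV2 ?posrE ?expR_gt0 ?divr_gt0 ?exprn_gt0 //.
    by have := expR_ge1Dxn 2 (ltW y0); rewrite -[(3 `!)%:R]/(6%:R : R); lra.
  by rewrite le_eqVlt; apply/orP; left; apply/eqP; rewrite /y; field; rewrite gt_eqF.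
have h5 : (q * q.+1).+1%:R * expR (- y) <= 1 / 4.
  apply: (@le_trans _ _ (3 * q%:R ^+ 2 * (6 * 800 ^+ 3 / q%:R ^+ 3))).
    by apply: ler_pM; rewrite ?ler0n ?expR_ge0.
  have -> : 3 * q%:R ^+ 2 * (6 * 800 ^+ 3 / q%:R ^+ 3) = 18 * 800 ^+ 3 / q%:R :> R.
    by field; rewrite gt_eqF.
  by rewrite ler_pdivrMr //; lra.
lra.
Qed.

(** Here ln n <= 2 L + 2 and ln ln n >= (l - 2) / 2, while 32 l <= 50 (l - 2) as l >= 64. *)
Lemma target_le (n : nat) : 9 / 20 * q%:R < n%:R :> R ->
  n%:R <= 11 / 20 * q%:R ^+ 2 :> R ->
  ln (n%:R : R) / (100 * ln (ln (n%:R : R))) <= t.+1%:R.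
Proof.
move=> n_lower n_upper; have l2 : (2 <= l)%N by exact: leq_trans l64.
have /andP[ln2_lower ln2_upper] := (ln2_bounds R).
have q0 : 0 < q%:R :> R by rewrite ltr0n order_gt0.
have n0 : 0 < n%:R :> R by lra.
have l64' : 64 <= l%:R :> R by rewrite ler_nat.
have Ll : 1024 * l%:R <= L%:R :> R by rewrite -natrM ler_nat L_ge_mul.
have /andP[q_lower q_upper] := q_bounds.
have ln_upper : ln (n%:R : R) <= 2 * L%:R + 2.
  apply: (@le_trans _ _ (ln (2 ^+ (2 * L.+1)))).
    rewrite ler_ln ?posrE ?exprn_gt0 //; apply: (le_trans n_upper).
    have : q%:R <= 2 ^+ L.+1 :> R by rewrite -natrX ler_nat ltnW.
    by rewrite mulnC exprM; have := exprn_gt0 L.+1 (ltr0n R 2); nra.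
  rewrite lnXn // -[leLHS]mulr_natl natrM -natr1.
  by have : 0 <= L%:R :> R by []; nra.
have ln_lower : 2 ^+ (l - 2) <= ln (n%:R : R).
  have e2 : 4 * 2 ^+ (l - 2) <= L%:R :> R.
    have /andP[h _] := L_bounds.
    rewrite -[4]/(4%:R) -natrX -natrM ler_nat; apply: leq_trans h.
    by rewrite -[4%N]/(2 ^ 2)%N -expnD subnKC.
  have L2 : (L - 2)%:R = L%:R - 2 :> R.
    by rewrite natrB // L_ge2.
  have : ln (2 ^+ (L - 2)) <= ln (n%:R : R).
    rewrite ler_ln ?posrE ?exprn_gt0 //; apply: le_trans (ltW n_lower).
    have : 4 * 2 ^+ (L - 2) <= q%:R :> R.
      rewrite -[4]/(4%:R) -natrX -natrM ler_nat; apply: leq_trans q_lower.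
      by rewrite -[4%N]/(2 ^ 2)%N -expnD subnKC // L_ge2.
    by have := exprn_gt0 (L - 2) (ltr0n R 2); lra.
  rewrite lnXn // -[leLHS]mulr_natl L2; nra.
have lnln_lower : (l%:R - 2) / 2 <= ln (ln (n%:R : R)).
  apply: (@le_trans _ _ (ln (2 ^+ (l - 2)))); last first.
    by rewrite ler_ln ?posrE ?exprn_gt0 //; apply: lt_le_trans ln_lower; rewrite exprn_gt0.
  rewrite lnXn // -[leRHS]mulr_natl natrB //.
  by nra.
have tl : L%:R + 1 <= t.+1%:R * (16 * l%:R) :> R.
  by rewrite natr1 -!natrM ler_nat ltn_load_boundS.
have t0 : 1 <= t.+1%:R :> R by rewrite ler1n.
rewrite ler_pdivrMr; last by lra.
apply: (le_trans ln_upper).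
apply: (@le_trans _ _ (t.+1%:R * (32 * l%:R))); first by lra.
by rewrite ler_pM2l; lra.
Qed.

End ParameterChoice.

(** * The design *)

Lemma design_of_plane (R : realType) (q : nat) (P L : finType)
    (pts : L -> {set P}) (S : {set P}) (T : R) :
  affine_plane pts q ->
  (forall l, 9 / 20 * q%:R < #|S :&: pts l|%:R :> R) ->
  #|S|%:R <= 11 / 20 * q%:R ^+ 2 :> R ->
  (forall Q : {set P}, Q \subset S -> (forall l, Q :&: pts l != set0) ->
    exists l, T <= #|Q :&: pts l|%:R) ->
  exists (S' : finType) (m : nat) (A : 'I_m -> {set S'}),
    [/\ block_design A, #|S'| = #|S|,
      (forall i : 'I_m, 6 / 10 * Num.sqrt (#|S|%:R : R) < #|A i|%:R)
      & forall Q : {set S'}, block_transversal A Q ->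
          exists i : 'I_m, T <= #|Q :&: A i|%:R].
Proof.
move=> [_ _ _ two] S_lines S_size S_transversal.
pose A (i : 'I_#|L|) := [set x : {x | x \in S} | val x \in pts (enum_val i)].
have cardA (Q : {set {x | x \in S}}) i :
    #|Q :&: A i| = #|(val @: Q) :&: pts (enum_val i)|.
  rewrite -(card_imset _ val_inj); congr #|pred_of_set _|.
  apply/setP => x; apply/imsetP/setIP => [[y /setIP[yQ yA] ->]|[/imsetP[y yQ ->] yl]].
    by rewrite imset_f //; move: yA; rewrite inE.
  by exists y; rewrite // inE yQ inE.
exists {x | x \in S}, #|L|, A; split.
- move=> x y xy.
  have vxy : val x != val y by rewrite (inj_eq val_inj).
  have /eqP/cards1P[l lE] := two _ _ vxy.
  exists (enum_rank l); split.
    have : l \in [set l] by rewrite inE.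
    by rewrite -lE !inE enum_rankK => /andP[].
  move=> i [xi yi].
  have : enum_val i \in [set l] by rewrite -lE inE; move: xi yi; rewrite !inE => -> ->.
  by rewrite inE => /eqP <-; rewrite enum_valK.
- by rewrite card_sig; apply: eq_card.
- move=> i; have -> : #|A i| = #|S :&: pts (enum_val i)|.
    rewrite -[A i]setTI cardA; congr #|pred_of_set (_ :&: _)|.
    apply/setP => x; apply/imsetP/idP => [[y _ ->]|xS]; first exact: valP.
    by exists (Sub x xS); rewrite ?inE ?SubK.
  apply: le_lt_trans (S_lines _).
  have q0 : 0 <= q%:R :> R by exact: ler0n.
  (* Indeed 11/20 <= (3/4)^2, and 6/10 times 3/4 is exactly the 9/20 of [S_lines]. *)
  have h : Num.sqrt (#|S|%:R : R) <= 3 / 4 * q%:R.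
    rewrite -[leRHS]ger0_norm; last by rewrite mulr_ge0 ?divr_ge0.
    rewrite -sqrtr_sqr ler_wsqrtr // (le_trans S_size) // exprMn.
    by have := sqr_ge0 (q%:R : R); lra.
  by lra.
- move=> Q Q_trans; have [||l hl] := S_transversal (val @: Q).
  + by apply/subsetP => _ /imsetP[x _ ->]; exact: valP.
  + move=> l; have := Q_trans (enum_rank l).
    by rewrite -!card_gt0 cardA enum_rankK.
  by exists (enum_rank l); rewrite cardA enum_rankK.
Qed.

Theorem theorem1p2 (R : realType) (n0 : int) :
  exists (n : nat) (S : finType) (m : nat) (A : 'I_m -> {set S}),
    [/\ n0 <= n%:Z,
        block_design A,
        #|S| = n,
        (forall i : 'I_m, 6 / 10 * Num.sqrt (n%:R : R) < #|A i|%:R)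
      & forall Q : {set S}, block_transversal A Q ->
          exists i : 'I_m,
            ln (n%:R : R) / (100 * ln (ln (n%:R : R))) <= #|Q :&: A i|%:R].
Proof.
(* The factor 4 is a margin, as [S] is only known to have more than [9 / 20 * q] points. *)
have [q [l [L [q_pr n0q l64 L_bounds q_bounds]]]] := exists_parameters (4 * `|n0|).
have plane := field_plane q_pr.
have q_gt0 : (0 < q)%N by exact: prime_gt0.
have t3 := load_bound_ge3 l64 L_bounds.
pose t := load_bound l L.
have [cs [size_cs cs_bound cs_cover]] := container_family R plane q_gt0 t3
  (fugacity_inv_ge36 l64 L_bounds) (fugacity_load_le l64 L_bounds q_bounds)
  (phase_cost_large l64 L_bounds q) (total_cost_le l64 L_bounds q_bounds)
  (phase_count_scale l64 L_bounds q_bounds).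
have [||||S [S_lines S_size S_cs]] := @exists_point_set R _ _ _ q plane q_gt0 (64 * t) cs.
- by rewrite muln_gt0 /=; exact: leq_trans t3.
- exact: (expn_load_bound_le l64 L_bounds q_bounds).
- move=> c /cs_bound[c1 c2 c3]; split=> //.
  rewrite -(leq_pmul2l (_ : 0 < 2 ^ phase_count l L q)%N) ?expn_gt0 //.
  apply: (leq_trans c2); rewrite mulnA leq_mul2r; apply/orP; right.
  exact: phase_count_fine.
- exact: failure_probability_lt1.
have q0 : 0 < q%:R :> R by rewrite ltr0n.
have S_lower : 9 / 20 * q%:R < #|S|%:R :> R.
  apply: lt_le_trans (S_lines (inr 0)) _.
  by rewrite ler_nat subset_leq_card // subsetIl.
pose T : R := ln (#|S|%:R : R) / (100 * ln (ln (#|S|%:R : R))).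
have Tt : T <= t.+1%:R by exact: (target_le l64 L_bounds q_bounds S_lower S_size).
have [|S' [m [A [designA cardS blockA transA]]]] :=
    @design_of_plane R q _ _ _ S T plane S_lines S_size.
  (* If all loads stay below [T <= t.+1], they are at most [t], so a pair covers [Q]; the line that
     this pair misses within [S] is then missed by [Q]. *)
  move=> Q QS Q_trans; apply/existsP/contraT; rewrite negb_exists => /forallP Q_small.
  have Qt : load_le (@field_line q) t Q.
    apply/forallP => l'; rewrite -ltnS -(ltr_nat R).
    by apply: lt_le_trans Tt; rewrite ltNge Q_small.
  have [c c_cs [cQ Qc]] := cs_cover Q Qt; have [l' cl'] := S_cs c c_cs.
  have /set0Pn[x /setIP[xQ xl']] := Q_trans l'.
  have : x \in (c.1 :|: c.2 :&: S) :&: field_line l'.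
    have := subsetP Qc x xQ; rewrite !inE xl' andbT (subsetP QS) // andbT.
    by case: (x \in c.1).
  by rewrite cl' inE.
exists #|S|, S', m, A; split=> //.
apply: (@le_trans _ _ `|n0|%:Z); first by rewrite abszE ler_norm.
rewrite lez_nat -(ler_nat R).
have : 4 * `|n0|%:R <= q%:R :> R by rewrite -natrM ler_nat.
by have : 0 <= `|n0|%:R :> R by []; lra.
Qed.
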